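(* Let $1\le p\le n$ and let $U_1,U_2\in\mathrm{St}(p,n)$ be such that all principal angles between the subspaces $\mathrm{span}(U_1)$ and $\mathrm{span}(U_2)$ of $\mathbb R^n$ are less than $\pi/2$. The singular value decomposition of the $p\times p$ matrix $U_1^TU_2$ can be written $$U_1^TU_2=O_1(\cos\Sigma)O_2^T,\qquad O_1,O_2\in\mathrm{O}(p),$$ where $\Sigma$ is the diagonal matrix whose diagonal entries are the principal angles between $\mathrm{span}(U_1)$ and $\mathrm{span}(U_2)$. For any pair $(O_1,O_2)\in\mathrm{O}(p)\times\mathrm{O}(p)$ given by such a decomposition, $(O_1,O_2)$ minimizes the function $$(Q_1,Q_2)\mapsto d_{\mathrm{St}(p,n)}(U_1Q_1,U_2Q_2)$$ over $\mathrm{O}(p)\times\mathrm{O}(p)$.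
   Context: $\mathrm{St}(p,n)=\{U\in\mathbb R^{n\times p}:U^TU=I_p\}$ is the Stiefel manifold, with the canonical Riemannian metric coming from $\mathrm{St}(p,n)=\mathrm{O}(n)/\mathrm{O}(n-p)$, i.e. $\langle\Delta,\Delta\rangle_U=\mathrm{Tr}(\Delta^T(I-\tfrac12UU^T)\Delta)$; $d_{\mathrm{St}(p,n)}$ is the associated geodesic distance. $\mathrm{Gr}(p,n)=\mathrm{St}(p,n)/\mathrm{O}(p)$ is the Grassmann manifold of $p$-dimensional subspaces of $\mathbb R^n$ with its natural Riemannian metric, for which $U\mapsto\mathrm{span}(U)$ is a Riemannian submersion and the squared distance between two subspaces is the sum of the squares of their principal angles. $\mathrm{span}(U)$ denotes the column space of $U$; $\cos\Sigma$ is the diagonal matrix of the cosines of the entries of $\Sigma$. *)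

(* Defs.v *)
From HB Require Import structures.
From mathcomp Require Export all_boot all_order all_fingroup all_algebra.
From mathcomp Require Export all_classical all_reals all_analysis.
Export Order.TTheory GRing.Theory Num.Theory.
Export numFieldNormedType.Exports.

Set Implicit Arguments.
Unset Strict Implicit.
Unset Printing Implicit Defensive.

Local Open Scope classical_set_scope.
Local Open Scope ring_scope.

Definition stiefel {R : realType} (n p : nat) : set 'M[R]_(n, p) :=
  [set U | U^T *m U = 1%:M].

Definition orthogonal_group {R : realType} (p : nat) : set 'M[R]_p :=
  [set Q | Q^T *m Q = 1%:M].

Definition colspan {R : realType} (n p : nat) (U : 'M[R]_(n, p)) :
    {vspace 'cV[R]_n} :=
  <<[seq col j U | j : 'I_p]>>%VS.

Definition dot {R : realType} (n : nat) (x y : 'cV[R]_n) : R :=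
  (x^T *m y) 0 0.

(* The vectors over which the k-th maximum in the recursive definition of the
   principal angles is taken: unit vectors of V that are orthogonal to the
   principal vectors u j already chosen, j < k. *)
Definition principal_candidate {R : realType} (n p : nat)
    (V : {vspace 'cV[R]_n}) (u : 'I_p -> 'cV[R]_n) (k : 'I_p)
    (x : 'cV[R]_n) : Prop :=
  [/\ x \in V, dot x x = 1 & forall j : 'I_p, (j < k)%N -> dot (u j) x = 0].

(* theta is the family theta_0 <= ... <= theta_(p-1) of principal angles in
   [0, pi/2] between the p-dimensional subspaces V and W:
     cos theta_k = max { x^T y | x in V, y in W unit vectors,
                         x _|_ u_j and y _|_ v_j for j < k } = u_k^T v_k. *)
Definition principal_angles {R : realType} (n p : nat)
    (V W : {vspace 'cV[R]_n}) (theta : 'I_p -> R) : Prop :=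
  (forall k, 0 <= theta k <= pi / 2) /\
  exists u v : 'I_p -> 'cV[R]_n, forall k,
    [/\ principal_candidate V u k (u k),
        principal_candidate W v k (v k),
        cos (theta k) = dot (u k) (v k) &
        forall x y, principal_candidate V u k x -> principal_candidate W v k y ->
          dot x y <= dot (u k) (v k)].

(* U1^T U2 = O1 (cos Sigma) O2^T with Sigma = diag(sigma), where the entries of
   sigma are the principal angles between span(U1) and span(U2), counted with
   multiplicity and listed in any order (hence the permutation s). *)
Definition principal_svd {R : realType} (n p : nat) (U1 U2 : 'M[R]_(n, p))
    (O1 : 'M[R]_p) (sigma : 'rV[R]_p) (O2 : 'M[R]_p) : Prop :=
  [/\ orthogonal_group O1, orthogonal_group O2,
      exists s : 'S_p,
        principal_angles (colspan U1) (colspan U2) (fun k => sigma 0 (s k)) &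
      U1^T *m U2 = O1 *m diag_mx (map_mx cos sigma) *m O2^T].

Definition canonical_metric {R : realType} (n p : nat)
    (U D1 D2 : 'M[R]_(n, p)) : R :=
  \tr (D1^T *m (1%:M - 2^-1 *: (U *m U^T)) *m D2).

(* C^1 on the closed interval [a, b]: the derivative on the open interval
   extends continuously up to the endpoints. *)
Definition C1_on {R : realType} (n p : nat) (a b : R)
    (g : R -> 'M[R]_(n, p)) : Prop :=
  [/\ {within `[a, b], continuous g},
      (forall t, a < t < b -> derivable g t 1) &
      exists2 dg : R -> 'M[R]_(n, p), {within `[a, b], continuous dg} &
        forall t, a < t < b -> derive1 g t = dg t].

Definition piecewise_C1 {R : realType} (n p : nat) (a b : R)
    (g : R -> 'M[R]_(n, p)) : Prop :=
  exists2 s : seq R, itv_partition a b s &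
    forall i, (i < size s)%N -> C1_on (nth a (a :: s) i) (nth a s i) g.

(* At the finitely many breakpoints the derivative may take an arbitrary value,
   which does not affect the integral. *)
Definition curve_length {R : realType} (n p : nat)
    (g : R -> 'M[R]_(n, p)) : \bar R :=
  (\int[@lebesgue_measure R]_(t in `[0%R, 1%R])
     (Num.sqrt (canonical_metric (g t) (derive1 g t) (derive1 g t)))%:E)%E.

(* Geodesic distance of the canonical metric: the infimum of the lengths of the
   piecewise C^1 curves of St(p, n) from U to V.  For U and V in St(p, n) it is
   +oo only when p = n and they lie in different components of O(n). *)
Definition stiefel_dist {R : realType} (n p : nat) (U V : 'M[R]_(n, p)) :
    \bar R :=
  ereal_inf [set curve_length g | g in
    [set g : R -> 'M[R]_(n, p) |
      [/\ piecewise_C1 0 1 g, (forall t, 0 <= t <= 1 -> stiefel (g t)),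
          g 0 = U & g 1 = V]]].

(* Main.v *)
Require Import Defs.
From mathcomp Require Import ring lra measurable_realfun.

(** Upper bound: for V1 = U1 O1, V2 = U2 O2 one has V1^T V2 = cos Sigma, so the
    curve t |-> V1 cos(t Sigma) + W sin(t Sigma), with
    W = (V2 - V1 cos Sigma) (sin Sigma)^-1, joins V1 to V2.  Its velocity is
    horizontal, of constant norm (sum_i sigma_i^2)^(1/2).

    Lower bound: the canonical metric dominates its horizontal part.  Instead
    of lifting a curve g horizontally, which needs an ODE, follow it by small
    steps, realigning g(t') with g(t) by the orthogonal factor of the polar
    decomposition of g(t)^T g(t').  In the limit this yields an orthogonal H
    such that, for EVERY orthogonal Q with columns q_i, the angles between
    g(0) q_i and g(1) H q_i have a sum of squares at most length(g)^2; this
    property composes by the spherical triangle inequality and Minkowski's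
    inequality.  Finally g(0)^T g(1) H has singular values cos sigma_i, and
    Fan and Hoffman's inequality provides a Q for which the diagonal entries of
    Q^T g(0)^T g(1) H Q are, after sorting, at most the cos sigma_i; hence the
    angles are at least the sigma_i. *)

Set Implicit Arguments.
Unset Strict Implicit.
Unset Printing Implicit Defensive.

Local Open Scope classical_set_scope.
Local Open Scope ring_scope.

(** * Orthogonal matrices, singular values and the Fan-Hoffman inequality *)

Section dot_product.
Context {R : realType}.

Lemma dotE n (x y : 'cV[R]_n) : dot x y = \sum_i x i 0 * y i 0.
Proof. by rewrite /dot mxE; apply: eq_bigr => i _; rewrite mxE. Qed.

Lemma trmx_mul_dot n (x y : 'cV[R]_n) : x^T *m y = (dot x y)%:M.
Proof. by apply/matrixP => i j; rewrite !ord1 [RHS]mxE eqxx. Qed.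

Lemma dotC n (x y : 'cV[R]_n) : dot x y = dot y x.
Proof. by rewrite !dotE; apply: eq_bigr => i _; rewrite mulrC. Qed.

Lemma dotDl n (x y z : 'cV[R]_n) : dot (x + y) z = dot x z + dot y z.
Proof. by rewrite /dot linearD mulmxDl mxE. Qed.

Lemma dotZl n a (x y : 'cV[R]_n) : dot (a *: x) y = a * dot x y.
Proof. by rewrite /dot linearZ -scalemxAl mxE. Qed.

Lemma dotDr n (x y z : 'cV[R]_n) : dot z (x + y) = dot z x + dot z y.
Proof. by rewrite /dot mulmxDr mxE. Qed.

Lemma dotZr n a (x y : 'cV[R]_n) : dot x (a *: y) = a * dot x y.
Proof. by rewrite /dot -scalemxAr mxE. Qed.

Lemma dot_mulmx m n (A : 'M[R]_(m, n)) x y : dot (A *m x) y = dot x (A^T *m y).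
Proof. by rewrite /dot trmx_mul mulmxA. Qed.

Lemma dot_ge0 n (x : 'cV[R]_n) : 0 <= dot x x.
Proof. by rewrite dotE sumr_ge0// => i _; rewrite -expr2 sqr_ge0. Qed.

Lemma dot_eq0 n (x : 'cV[R]_n) : dot x x = 0 -> x = 0.
Proof.
rewrite dotE => /eqP; rewrite psumr_eq0 => [/allP x0|i _]; last first.
  by rewrite -expr2 sqr_ge0.
apply/colP => i; rewrite mxE; apply/eqP.
by have := x0 i; rewrite mem_index_enum mulf_eq0 orbb => /(_ isT).
Qed.

Lemma dot_le_mid n (x y : 'cV[R]_n) : dot x y <= (dot x x + dot y y) / 2.
Proof.
have := dot_ge0 (x + (-1) *: y).
rewrite !(dotDl, dotDr, dotZl, dotZr) (dotC y x); lra.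
Qed.

Lemma dot_cauchy n (x y : 'cV[R]_n) : dot x y ^+ 2 <= dot x x * dot y y.
Proof.
have [y0|y0] := eqVneq (dot y y) 0.
  rewrite y0 (dot_eq0 y0) mulr0 -(scale0r (0 : 'cV_n)) dotZr mul0r expr0n/=.
  by [].
have y_gt0 : 0 < dot y y by rewrite lt0r y0 dot_ge0.
have := dot_ge0 (dot y y *: x + (- dot x y) *: y).
rewrite !(dotDl, dotDr, dotZl, dotZr) (dotC y x) => h.
have {}h : 0 <= dot y y * (dot x x * dot y y - dot x y ^+ 2).
  by rewrite (le_trans h)// le_eqVlt; apply/orP; left; apply/eqP; ring.
by rewrite pmulr_rge0// subr_ge0 in h.
Qed.

Lemma dot_cauchy_sqrt n (x y : 'cV[R]_n) (a b : R) : 0 <= a -> 0 <= b ->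
  dot x x <= a ^+ 2 -> dot y y <= b ^+ 2 -> dot x y <= a * b.
Proof.
move=> a0 b0 xa yb; have [|xy0] := leP (dot x y) 0.
  by move/le_trans; apply; rewrite mulr_ge0.
rewrite -(@ler_pXn2r _ 2) ?nnegrE ?mulr_ge0 ?(ltW xy0)// exprMn.
by apply: le_trans (dot_cauchy x y) _; rewrite ler_pM ?dot_ge0.
Qed.

Lemma dot_minkowski n (x y : 'cV[R]_n) (a b : R) : 0 <= a -> 0 <= b ->
  dot x x <= a ^+ 2 -> dot y y <= b ^+ 2 ->
  dot (x + y) (x + y) <= (a + b) ^+ 2.
Proof.
move=> a0 b0 xa yb; have := dot_cauchy_sqrt a0 b0 xa yb.
rewrite !(dotDl, dotDr) (dotC y x); nra.
Qed.

End dot_product.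

Section orthogonal.
Context {R : realType}.

Lemma orthogonal_mulT p (Q : 'M[R]_p) : orthogonal_group Q -> Q *m Q^T = 1%:M.
Proof. by move=> /mulmx1C. Qed.

Lemma orthogonal_tr p (Q : 'M[R]_p) :
  orthogonal_group Q -> orthogonal_group Q^T.
Proof. by rewrite /orthogonal_group/= trmxK => /mulmx1C. Qed.

Lemma orthogonal1 p : orthogonal_group (1%:M : 'M[R]_p).
Proof. by rewrite /orthogonal_group/= trmx1 mulmx1. Qed.

Lemma stiefel_mul n p q (U : 'M[R]_(n, p)) (Q : 'M[R]_(p, q)) :
  stiefel U -> stiefel Q -> stiefel (U *m Q).
Proof.
rewrite /stiefel/= => hU hQ.
by rewrite trmx_mul mulmxA -(mulmxA Q^T) hU mulmx1.
Qed.

Lemma dot_stiefel n p (U : 'M[R]_(n, p)) x y :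
  stiefel U -> dot (U *m x) (U *m y) = dot x y.
Proof. by move=> hU; rewrite dot_mulmx mulmxA hU mul1mx. Qed.

(** The reflection that exchanges [x] and the first basis vector [e] is orthogonal and sends [e] to
    [x]. It completes a unit vector to an orthonormal basis in the inductions below. *)
Lemma householder m (x : 'cV[R]_m.+1) : dot x x = 1 ->
  exists2 A : 'M[R]_m.+1, orthogonal_group A & col 0 A = x.
Proof.
move=> x1; pose e : 'cV[R]_m.+1 := col 0 1%:M.
have e1 : dot e e = 1.
  rewrite dotE (bigD1 0)//= big1 ?addr0 => [|i i0]; rewrite !mxE ?mulr1//.
  by rewrite eq_sym eq_sym (negbTE i0) mul0r.
pose w := x + (-1) *: e.
have ww : dot w w = 2 - 2 * dot x e.
  by rewrite !(dotDl, dotDr, dotZl, dotZr) x1 e1 (dotC e x); ring.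
have we : dot w e = - (dot w w) / 2.
  by rewrite ww !(dotDl, dotZl) e1; field.
(* If [x = e] there is no reflecting direction, and the identity serves. *)
have [w0|w0] := eqVneq (dot w w) 0.
  exists 1%:M; first exact: orthogonal1.
  by move: (dot_eq0 w0); rewrite /w scaleN1r => /subr0_eq ->.
pose A := 1%:M - (2 / dot w w) *: (w *m w^T).
have AT : A^T = A by rewrite /A linearB linearZ/= trmx1 trmx_mul trmxK.
exists A.
  rewrite /orthogonal_group/= AT /A mulmxBl mul1mx mulmxBr mulmx1.
  rewrite -scalemxAl -scalemxAr mulmxA -(mulmxA w) trmx_mul_dot mul_mx_scalar -scalemxAl.
  rewrite !scalerA (_ : 2 / _ * (2 / _ * _) = 2 / dot w w + 2 / dot w w); last by field.
  by rewrite scalerDl opprB addrK subrK.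
have -> : col 0 A = A *m e by rewrite /e !colE mul1mx.
rewrite /A mulmxBl mul1mx -scalemxAl -mulmxA.
rewrite trmx_mul_dot mul_mx_scalar scalerA we (_ : 2 / _ * _ = -1); last by field.
by rewrite scaleN1r opprK /w scaleN1r addrC subrK.
Qed.

End orthogonal.

(** * Limits of matrix-valued functions, entry by entry *)

Section matrix_limits.
Context {R : realType} {T : Type} {F : set_system T} {FF : Filter F}.

Lemma cvg_mxP m n (f : T -> 'M[R]_(m, n)) (l : 'M[R]_(m, n)) :
  f @ F --> l <-> forall i j, (fun x => f x i j) @ F --> l i j.
Proof.
split=> [fl i j|fl].
  exact: (cvg_comp _ _ fl (@coord_continuous _ _ _ i j l)).
apply/cvgrPdist_le => /= e e0; near=> x.
rewrite /Num.Def.normr/= mx_normrE (bigmax_le _ (ltW e0))//= => i _.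
rewrite !mxE; move: i; near: x; apply: filter_forall => /= i.
exact: ((cvgrPdist_le _ _).1 (fl i.1 i.2)).
Unshelve. all: by end_near. Qed.

Lemma cvg_mulmx m n p (f : T -> 'M[R]_(m, n)) (g : T -> 'M[R]_(n, p))
    (a : 'M[R]_(m, n)) (b : 'M[R]_(n, p)) :
  f @ F --> a -> g @ F --> b -> (fun x => f x *m g x) @ F --> a *m b.
Proof.
move=> /cvg_mxP fa /cvg_mxP gb; apply/cvg_mxP => i j; rewrite mxE.
under eq_fun do rewrite mxE.
by apply: cvg_big => [|k _]; [exact: add_continuous|exact: cvgM].
Qed.

Lemma cvg_trmx m n (f : T -> 'M[R]_(m, n)) (a : 'M[R]_(m, n)) :
  f @ F --> a -> (fun x => (f x)^T) @ F --> a^T.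
Proof.
move=> /cvg_mxP fa; apply/cvg_mxP => i j; rewrite mxE.
by under eq_fun do rewrite mxE; exact: fa.
Qed.

Lemma cvg_mxtrace n (f : T -> 'M[R]_n) (a : 'M[R]_n) :
  f @ F --> a -> (fun x => \tr (f x)) @ F --> \tr a.
Proof.
move=> /cvg_mxP fa.
by apply: cvg_big => [|k _]; [exact: add_continuous|exact: fa].
Qed.

End matrix_limits.

Section quadratic_form.
Context {R : realType}.

(** The quadratic form attains its minimum on the unit sphere by compactness, and homogeneity
    extends the bound to all [y]. *)
Lemma quadratic_min m (N : 'M[R]_m.+1) : exists2 x : 'cV[R]_m.+1,
  dot x x = 1 & forall y, dot x (N *m x) * dot y y <= dot y (N *m y).
Proof.
(* The compactness argument runs on row vectors, hence the transposes. With [M = 1%:M] the same [q]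
   gives the squared norm that defines the sphere. *)
pose q (M : 'M[R]_m.+1) (v : 'rV[R]_m.+1) := dot v^T (M *m v^T).
have qc M : continuous (q M).
  move=> v; have : (fun u : 'rV[R]_m.+1 => u *m (M *m u^T)) @ v --> v *m (M *m v^T).
    have cv : id @ nbhs v --> v by exact: cvg_id.
    exact: (cvg_mulmx cv (cvg_mulmx (cvg_cst M) (cvg_trmx cv))).
  move=> /cvg_mxP /(_ 0 0); suff -> : q M = fun u => (u *m (M *m u^T)) 0 0 by [].
  by apply/funext => u; rewrite /q /dot trmxK.
pose A := [set v : 'rV[R]_m.+1 | q 1%:M v = 1].
have qZ M a v : q M (a *: v) = a ^+ 2 * q M v.
  by rewrite /q linearZ/= -scalemxAr dotZl dotZr mulrA.
have A0 : A !=set0.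
  exists (delta_mx 0 0); rewrite /A/= /q mul1mx dotE (bigD1 0)//= big1 ?addr0.
    by rewrite !mxE eqxx mulr1.
  by move=> i i0; rewrite !mxE/= (negbTE i0) mul0r.
have Acl : closed A.
  apply: (@closed_comp _ _ (q 1%:M) [set x | x = 1]); last exact: closed_eq.
  by move=> v _; exact: qc.
have Abd : bounded_set A.
  exists 1; split=> // M M1 v; rewrite /A/= /q mul1mx dotE => vA.
  rewrite /Num.Def.normr/= mx_normrE (bigmax_le)//= ?(ltW (lt_trans ltr01 M1))//.
  move=> -[i j] _; rewrite ord1/= (le_trans _ (ltW M1))//.
  rewrite -(@ler_pXn2r _ 2) ?nnegrE// expr1n -vA (bigD1 j)//= !mxE.
  rewrite -normrX ger0_norm ?sqr_ge0// -expr2 lerDl sumr_ge0// => k _.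
  by rewrite -expr2 sqr_ge0.
have [v vA vmin] := compact_EVT_min A0 (bounded_closed_compact Abd Acl)
  (continuous_subspaceT (qc N)).
move: vA; rewrite inE /A/= /q mul1mx => vA.
exists v^T => // y; have [y0|y0] := eqVneq (dot y y) 0.
  by rewrite (dot_eq0 y0) -(scale0r (0 : 'cV[R]_m.+1)) !dotZl !mul0r mulr0.
have y_gt0 : 0 < dot y y by rewrite lt0r y0 dot_ge0.
pose a := (Num.sqrt (dot y y))^-1.
have a2 : a ^+ 2 = (dot y y)^-1 by rewrite exprVn sqr_sqrtr ?ltW.
have := vmin (a *: y^T).
rewrite inE /A/= !qZ {1}/q trmxK mul1mx a2 mulVf// => /(_ erefl).
by rewrite {2}/q trmxK mulrC ler_pdivlMr // [in X in _ -> X]mulrC.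
Qed.

End quadratic_form.

Section orthogonal_block.
Context {R : realType}.

Lemma orthogonal_mul p (P Q : 'M[R]_p) :
  orthogonal_group P -> orthogonal_group Q -> orthogonal_group (P *m Q).
Proof. exact: stiefel_mul. Qed.

Lemma orthogonal_block1 p (Q : 'M[R]_p) : orthogonal_group Q ->
  orthogonal_group (block_mx 1%:M 0 0 Q : 'M[R]_(1 + p)).
Proof.
rewrite /orthogonal_group/= => hQ.
rewrite tr_block_mx trmx1 !trmx0 mulmx_block !mulmx0 !mul0mx !mulmx1 !add0r.
by rewrite addr0 hQ -scalar_mx_block.
Qed.

Lemma dot_col_mx m n (a c : 'cV[R]_m) (b d : 'cV[R]_n) :
  dot (col_mx a b) (col_mx c d) = dot a c + dot b d.
Proof. by rewrite /dot tr_col_mx mul_row_col mxE. Qed.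

Lemma dot_delta p (M : 'M[R]_p) i :
  dot (delta_mx i 0) (M *m delta_mx i 0) = M i i.
Proof. by rewrite /dot trmx_delta -rowE -colE !mxE. Qed.

Lemma dot_delta1 p (i : 'I_p) :
  dot (delta_mx i 0) (delta_mx i 0) = 1 :> R.
Proof. by rewrite -[X in dot _ X]mul1mx dot_delta mxE eqxx. Qed.

End orthogonal_block.

Section spectral.
Context {R : realType}.

(** Each column of [Q] minimizes the form of [N] among the unit vectors orthogonal to the earlier
    columns: [Q] is an eigenbasis of the symmetric part of [N], with increasing eigenvalues. The
    induction splits off a global minimizer and recurses on the complementary block. *)
Lemma minimizing_frame p (N : 'M[R]_p) : exists2 Q : 'M[R]_p, orthogonal_group Q &
  forall (k : 'I_p) (x : 'cV[R]_p), (forall j : 'I_p, (j < k)%N -> x j 0 = 0) ->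
    (Q^T *m N *m Q) k k * dot x x <= dot x (Q^T *m N *m Q *m x).
Proof.
elim: p N => [|p IH] N; first by exists 1%:M; [exact: orthogonal1|case].
have [v v1 vmin] := quadratic_min N.
have [A hA colA] := householder v1.
pose N1 : 'M[R]_(1 + p) := A^T *m N *m A.
have [Q' hQ' IHQ] := IH (drsubmx N1).
pose B : 'M[R]_(1 + p) := block_mx 1%:M 0 0 Q'.
have hB : orthogonal_group B by exact: orthogonal_block1.
pose Q : 'M[R]_p.+1 := A *m B.
have hQ : orthogonal_group Q by exact: orthogonal_mul.
have QN (x : 'cV[R]_p.+1) : dot x (Q^T *m N *m Q *m x) = dot (Q *m x) (N *m (Q *m x)).
  by rewrite dot_mulmx !mulmxA.
exists Q => // k x xk; rewrite -dot_delta.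
have [k0|[k' kE]] : k = 0 \/ exists k' : 'I_p, k = rshift 1 k'.
- case: (@split_ordP 1 p k) => [j ->|j ->]; last by right; exists j.
  by left; apply/val_inj; rewrite /= ord1.
- rewrite !QN k0; have -> : Q *m delta_mx 0 0 = v.
    rewrite -mulmxA -colA colE; congr (A *m _).
    rewrite -colE; apply/colP => i; rewrite [LHS]mxE [RHS]mxE /B.
    have -> : (0 : 'I_p.+1) = lshift p (0 : 'I_1) by exact/val_inj.
    case: (@split_ordP 1 p i) => j -> {i}.
      by rewrite (@block_mxEul R 1 p 1 p 1%:M 0 0 Q') mxE !ord1 !eqxx.
    by rewrite (@block_mxEdl R 1 p 1 p 1%:M 0 0 Q') mxE.
  by rewrite -[dot x x](dot_stiefel x x hQ); exact: vmin.
(* For [k > 0] the vector [x] has first coordinate zero, so only the lower right block of [N1] is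
   seen and the induction hypothesis applies. *)
pose l (y : 'cV[R]_p) : 'cV[R]_(1 + p) := col_mx 0 y.
have key y : dot (l y) (Q^T *m N *m Q *m l y) =
             dot y (Q'^T *m drsubmx N1 *m Q' *m y).
  have Bl : B *m l y = l (Q' *m y).
    by rewrite /B mul_block_col !mulmx0 mul0mx !add0r.
  have N1l z : N1 *m l z = col_mx (ursubmx N1 *m z) (drsubmx N1 *m z).
    by rewrite -{1}(submxK N1) mul_block_col !mulmx0 !add0r.
  transitivity (dot (B *m l y) (N1 *m (B *m l y))).
    by rewrite QN -!mulmxA dot_mulmx.
  rewrite Bl N1l dot_col_mx {1}/dot trmx0 mul0mx mxE add0r.
  by rewrite dot_mulmx !mulmxA.
have xE : x = l (dsubmx (x : 'cV_(1 + p))).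
  rewrite /l (_ : 0 = usubmx (x : 'cV_(1 + p))) ?vsubmxK//.
  by apply/colP => i; rewrite !mxE xk// kE/= ord1.
have dE : delta_mx k 0 = l (delta_mx k' 0).
  rewrite kE; apply/colP => i; case: (@split_ordP 1 p i) => j ->.
    by rewrite /l (@col_mxEu R 1 p 1 0) !mxE -val_eqE/= ord1.
  by rewrite /l (@col_mxEd R 1 p 1 0) !mxE -!val_eqE/= eqn_add2l.
have ll y : dot (l y) (l y) = dot y y.
  by rewrite dot_col_mx {1}/dot mulmx0 mxE add0r.
move: xE; set y := dsubmx _ => xE.
rewrite xE dE !key ll dot_delta.
by apply: IHQ => j jk; rewrite mxE xk// kE.
Qed.

(** Take a unit [v] at which the norm of [M v] is largest. In orthonormal bases that start with
    [M v] normalized and with [v], the matrix splits into the operator norm [c] and a smaller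
    block. *)
Lemma svd p (M : 'M[R]_p) : exists (A B : 'M[R]_p) (d : 'rV[R]_p),
  [/\ orthogonal_group A, orthogonal_group B, M = A *m diag_mx d *m B^T,
      forall i, 0 <= d 0 i & forall i j : 'I_p, (i <= j)%N -> d 0 j <= d 0 i].
Proof.
elim: p M => [|p IH] M.
  exists 1%:M, 1%:M, 0; split; [exact: orthogonal1|exact: orthogonal1| |by case|by case].
  by apply/matrixP => -[].
have [v v1 vmax] := quadratic_min (- (M^T *m M)).
set c2 := dot (M *m v) (M *m v).
have {}vmax y : dot (M *m y) (M *m y) <= c2 * dot y y.
  have MN (x : 'cV[R]_p.+1) : dot x (- (M^T *m M) *m x) = - dot (M *m x) (M *m x).
    by rewrite dot_mulmx -scaleN1r -scalemxAl dotZr mulN1r mulmxA.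
  by have := vmax y; rewrite !MN mulNr lerN2.
have [c20|c20] := eqVneq c2 0.
  exists 1%:M, 1%:M, 0; split; [exact: orthogonal1|exact: orthogonal1| | |].
  - rewrite mul1mx trmx1 mulmx1 linear0; apply/matrixP => i j.
    have : M *m delta_mx j (0 : 'I_1) = 0.
      apply: dot_eq0; apply/eqP; rewrite eq_le dot_ge0 andbT.
      by rewrite (le_trans (vmax _))// c20 mul0r.
    by rewrite -colE => /colP/(_ i); rewrite !mxE.
  - by move=> i; rewrite mxE.
  - by move=> i j _; rewrite !mxE.
have c2_gt0 : 0 < c2 by rewrite lt0r c20 dot_ge0.
pose c := Num.sqrt c2.
have c0 : 0 < c by rewrite sqrtr_gt0.
have cc : c ^+ 2 = c2 by rewrite sqr_sqrtr ?ltW.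
pose u := c^-1 *: (M *m v).
have u1 : dot u u = 1 by rewrite dotZl dotZr -/c2 -cc; field; rewrite gt_eqF.
have [A hA colA] := householder u1.
have [B hB colB] := householder v1.
pose M1 : 'M[R]_p.+1 := A^T *m M *m B.
have M1max y : dot (M1 *m y) (M1 *m y) <= c2 * dot y y.
  have hAT := orthogonal_tr hA.
  by rewrite -!mulmxA dot_stiefel// (le_trans (vmax _))// dot_stiefel.
have M1col : M1 *m delta_mx 0 (0 : 'I_1) = c *: delta_mx 0 0.
  rewrite /M1 -!mulmxA -[B *m _]colE colB.
  have -> : M *m v = c *: u by rewrite /u scalerA divff ?gt_eqF// scale1r.
  by rewrite -scalemxAr -colA colE mulmxA hA mul1mx.
have ME : M = A *m M1 *m B^T.
  rewrite /M1 !mulmxA (orthogonal_mulT hA) mul1mx -mulmxA (orthogonal_mulT hB).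
  by rewrite mulmx1.
clearbody M1; pose r := (row 0 M1)^T.
(* The first row [r] satisfies |r|^2 = e_0 . M1 r <= c |r|, so |r| <= c. Its first entry is already
   [c], hence its other entries vanish. *)
have rr : dot r r = c2.
  apply/le_anti/andP; split.
    have rE : dot (delta_mx 0 0) (M1 *m r) = dot r r.
      by rewrite /dot trmx_delta mulmxA -rowE trmxK.
    have := dot_cauchy (delta_mx 0 0) (M1 *m r).
    rewrite rE dot_delta1 mul1r => h.
    have {h} := le_trans h (M1max r).
    have [->|r0] := eqVneq (dot r r) 0; first by move=> _; apply: ltW.
    by rewrite expr2 ler_pM2r// lt0r r0 dot_ge0.
  rewrite dotE (bigD1 0)//= !mxE.
  have -> : M1 0 0 = c.
    by have /colP/(_ 0) := M1col; rewrite -colE !mxE eqxx mulr1.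
  by rewrite -expr2 cc lerDl sumr_ge0// => i _; rewrite -expr2 sqr_ge0.
have M1E : M1 = block_mx (c%:M : 'M[R]_1) 0 0 (drsubmx (M1 : 'M[R]_(1 + p))).
  have M1i0 i : M1 i 0 = c * (i == 0)%:R.
    by have /colP/(_ i) := M1col; rewrite -colE !mxE andbT.
  have M10j j : j != 0 -> M1 0 j = 0.
    move=> j0; move: rr; rewrite dotE (bigD1 0)//= !mxE M1i0 eqxx mulr1 -expr2 cc.
    move/eqP; rewrite -subr_eq0 addrAC subrr add0r psumr_eq0 => [/allP/(_ j)|i _].
      by rewrite mem_index_enum j0/= !mxE mulf_eq0 orbb => /(_ isT)/eqP.
    by rewrite -expr2 sqr_ge0.
  have z : lshift p 0 = 0 :> 'I_(1 + p) by exact/val_inj.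
  rewrite -[LHS](@submxK _ 1 p 1 p).
  have -> : ulsubmx (M1 : 'M[R]_(1 + p)) = c%:M.
    by apply/matrixP => i j; rewrite !ord1 !mxE z M1i0 !eqxx mulr1 mulr1n.
  have -> : ursubmx (M1 : 'M[R]_(1 + p)) = 0.
    by apply/matrixP => i j; rewrite !mxE ord1 z M10j.
  have -> : dlsubmx (M1 : 'M[R]_(1 + p)) = 0.
    by apply/matrixP => i j; rewrite !mxE ord1 z M1i0 mulr0.
  by [].
move: M1E; set M' := drsubmx _ => M1E.
have [A' [B' [d' [hA' hB' M'E d'0 d's]]]] := IH M'.
(* The singular values of the block are norms of [M1] at unit vectors, so [c] comes first in the
   decreasing order. *)
have d'c i : d' 0 i <= c.
  rewrite -(@ler_pXn2r _ 2) ?nnegrE ?(ltW c0)// cc.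
  pose y := B' *m delta_mx i (0 : 'I_1).
  have dz (z : 'cV[R]_p) : dot (col_mx (0 : 'cV[R]_1) z) (col_mx 0 z) = dot z z.
    by rewrite dot_col_mx {1}/dot mulmx0 mxE add0r.
  have := M1max (col_mx (0 : 'cV[R]_1) y).
  have -> : M1 *m col_mx (0 : 'cV[R]_1) y = col_mx (0 : 'cV[R]_1) (M' *m y).
    by rewrite M1E (@mul_block_col _ 1 p 1 p) !mulmx0 mul0mx !add0r.
  rewrite !dz /y (dot_stiefel _ _ hB') dot_delta1 mulr1 M'E -!mulmxA (dot_stiefel _ _ hA').
  rewrite [B'^T *m _]mulmxA hB' mul1mx -colE.
  apply: le_trans; rewrite dotE (bigD1 i)//= big1 => [|j ji].
    by rewrite !mxE eqxx addr0 mulr1n -expr2.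
  by rewrite !mxE (negbTE ji) mulr0.
pose bA : 'M[R]_(1 + p) := block_mx 1%:M 0 0 A'.
pose bB : 'M[R]_(1 + p) := block_mx 1%:M 0 0 B'.
pose d : 'rV[R]_(1 + p) := row_mx c%:M d'.
have hbA : orthogonal_group bA by exact: orthogonal_block1.
have hbB : orthogonal_group bB by exact: orthogonal_block1.
have M1E' : M1 = bA *m diag_mx d *m bB^T.
  rewrite M1E M'E /bA /bB /d diag_mx_row tr_block_mx trmx1 !trmx0 !mulmx_block.
  rewrite !mulmx0 !mul0mx !mulmx1 !mul1mx !addr0 !add0r.
  rewrite mul0mx; suff -> : diag_mx (c%:M : 'rV[R]_1) = c%:M by [].
  by apply/matrixP => i j; rewrite !ord1 !mxE.
exists (A *m bA), (B *m bB), d; split.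
- exact: orthogonal_mul.
- exact: orthogonal_mul.
- by rewrite ME M1E' trmx_mul !mulmxA.
- move=> i; case: (@split_ordP 1 p i) => j ->.
    by rewrite (@row_mxEl _ 1 1 p) mxE ord1 mulr1n ltW.
  by rewrite (@row_mxEr _ 1 1 p).
- move=> i j; case: (@split_ordP 1 p i) => i' ->; case: (@split_ordP 1 p j) => j' ->.
  + by rewrite !ord1.
  + by rewrite (@row_mxEr _ 1 1 p) (@row_mxEl _ 1 1 p) ord1 mxE mulr1n.
  + by rewrite ord1.
  + by rewrite !(@row_mxEr _ 1 1 p) /= leq_add2l; exact: d's.
Qed.

(** Entry by entry this is b x y <= m (x^2 + y^2) / 2 for 0 <= b <= m; an entry of [c] may exceed
    [m] only where [z] vanishes. *)
Lemma dot_diag_le p (c : 'rV[R]_p) (m : R) (z w : 'cV[R]_p) : 0 <= m ->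
  (forall i, 0 <= c 0 i) -> (forall i, z i 0 = 0 \/ c 0 i <= m) ->
  dot z (diag_mx c *m w) <= m * ((dot z z + dot w w) / 2).
Proof.
move=> m0 c0 zc; rewrite !dotE -big_split/= mulr_suml mulr_sumr.
apply: ler_sum => i _; rewrite mul_diag_mx mxE.
case: (zc i) => [->|cm].
  by rewrite !mul0r add0r mulr_ge0// divr_ge0// -expr2 sqr_ge0.
have := c0 i; move: (c _ _) (z _ _) (w _ _) cm => b x1 x2 bm b0.
have := sqr_ge0 (x1 - x2); have := sqr_ge0 (x1 + x2); nra.
Qed.

(** The k-th smallest eigenvalue of the symmetric part is at most the k-th smallest singular value:
    some nonzero vector lies both in the span of the eigenvectors from rank k on and where only the
    small singular values act. [rev_ord] appears because [minimizing_frame] lists eigenvalues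
    upwards while [s] lists [c] downwards. *)
Lemma fan_hoffman p (A B : 'M[R]_p) (c : 'rV[R]_p) (s : 'S_p) :
  orthogonal_group A -> orthogonal_group B -> (forall j, 0 <= c 0 j) ->
  (forall i j : 'I_p, (i <= j)%N -> c 0 (s j) <= c 0 (s i)) ->
  exists2 Q : 'M[R]_p, orthogonal_group Q & forall k,
    (Q^T *m (A *m diag_mx c *m B) *m Q) k k <= c 0 (s (rev_ord k)).
Proof.
move=> hA hB c0 cs; have [Q hQ Qmin] := minimizing_frame (A *m diag_mx c *m B).
exists Q => // k.
(* The p - 1 conditions x_j = 0 (j < k) and (A^T Q x)_(s (rev j)) = 0 (j > k)
   have a common nonzero solution; column k of T is the spare zero column. *)
pose T := \matrix_(i, j) (if (j < k)%N then (i == j)%:R else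
  if j == k then 0 else (A^T *m Q) (s (rev_ord j)) i).
have /det0P[v v0 vT] : \det T == 0.
  rewrite (expand_det_col T k) big1// => i _.
  by rewrite mxE ltnn eqxx mul0r.
pose x := v^T.
have xx : 0 < dot x x.
  rewrite lt0r dot_ge0 andbT; apply: contra_neq v0 => /dot_eq0 /(congr1 trmx).
  by rewrite trmxK trmx0.
have vTj j : \sum_i v 0 i * T i j = 0.
  by move/rowP : vT => /(_ j); rewrite !mxE.
have xk (j : 'I_p) : (j < k)%N -> x j 0 = 0.
  move=> jk; rewrite mxE -[RHS](vTj j) (bigD1 j)//= big1 ?addr0.
    by rewrite mxE jk eqxx mulr1.
  by move=> i ij; rewrite mxE jk (negbTE ij) mulr0.
pose z := A^T *m (Q *m x).
have zk (m : 'I_p) : (m < rev_ord k)%N -> z (s m) 0 = 0.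
  move=> mk; rewrite /z mulmxA mxE -[RHS](vTj (rev_ord m)); apply: eq_bigr => i _.
  have km : (k < rev_ord m)%N by move: mk; rewrite /= !ltn_subRL !addSn addnC.
  rewrite [T _ _]mxE ltnNge (ltnW km)/= -val_eqE (gtn_eqF km) rev_ordK mulrC.
  by rewrite /x [v^T _ _]mxE.
pose w := B *m (Q *m x).
have ww : dot w w = dot x x by rewrite dot_stiefel// dot_stiefel.
have zz : dot z z = dot x x.
  by rewrite dot_stiefel; [rewrite dot_stiefel|exact: orthogonal_tr].
rewrite -(ler_pM2r xx) (le_trans (Qmin k x xk))//.
have -> : dot x (Q^T *m (A *m diag_mx c *m B) *m Q *m x) = dot z (diag_mx c *m w).
  by rewrite /z /w dot_mulmx trmxK -!mulmxA -dot_mulmx.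
have -> : dot x x = (dot z z + dot w w) / 2 by rewrite zz ww; field.
apply: dot_diag_le => // i.
have [m ->] : exists m, i = s m by exists (s^-1%g i); rewrite permKV.
by have [/zk|/cs] := ltnP m (rev_ord k); [left|right].
Qed.

End spectral.

(** * Principal angles *)

Section principal.
Context {R : realType}.

Lemma colspanP n p (U : 'M[R]_(n, p)) x :
  x \in colspan U <-> exists a, x = U *m a.
Proof.
split=> [|[a ->]].
- pose f : 'Hom('cV[R]_p, 'cV[R]_n) := linfun (mulmx U).
  have /subvP sub : (colspan U <= limg f)%VS.
    apply/span_subvP => y /mapP[j _ ->]; rewrite colE.
    by rewrite -[U *m _](lfunE (mulmx U : {linear _ -> _})) memv_img ?memvf.
  by move=> /sub /memv_imgP[a _ ->]; exists a; rewrite lfunE.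
- have -> : U *m a = \sum_j a j 0 *: col j U.
    apply/colP => i; rewrite mxE summxE; apply: eq_bigr => j _.
    by rewrite !mxE mulrC.
  apply: rpred_sum => j _; apply: rpredZ; apply: memv_span.
  by apply/mapP; exists j; rewrite ?mem_enum.
Qed.

Lemma dot_unit_itv n (x y : 'cV[R]_n) : dot x x = 1 -> dot y y = 1 ->
  -1 <= dot x y <= 1.
Proof.
move=> x1 y1; have := dot_le_mid x y; have := dot_le_mid (-1 *: x) y.
rewrite !(dotZl, dotZr) x1 y1; lra.
Qed.

Lemma dot_col_orthogonal p (Q : 'M[R]_p) i : orthogonal_group Q ->
  dot (col i Q) (col i Q) = 1.
Proof. by move=> hQ; rewrite colE dot_stiefel// dot_delta1. Qed.

Lemma dot_col p (Q : 'M[R]_p) j a : dot (col j Q) a = (Q^T *m a) j 0.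
Proof. by rewrite dotE mxE; apply: eq_bigr => i _; rewrite !mxE. Qed.

(** The columns of [U1 *m A] and [U2 *m B], for a sorted singular value decomposition, are principal
    vectors: in the basis [A] a candidate of rank [k] has its first [k] coordinates zero, so it
    meets only singular values at most [d 0 k]. *)
Lemma principal_svd_exists n p (U1 U2 : 'M[R]_(n, p)) :
  stiefel U1 -> stiefel U2 ->
  exists (O1 : 'M[R]_p) (sigma : 'rV[R]_p) (O2 : 'M[R]_p),
    principal_svd U1 U2 O1 sigma O2.
Proof.
move=> hU1 hU2; have [A [B [d [hA hB ME d0 ds]]]] := svd (U1^T *m U2).
pose u k := U1 *m col k A; pose v k := U2 *m col k B.
have dotM a b : dot (U1 *m a) (U2 *m b) =
    dot (A^T *m a) (diag_mx d *m (B^T *m b)).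
  by rewrite dot_mulmx mulmxA ME -!mulmxA dot_mulmx trmxK.
have Ocol (Q : 'M[R]_p) k : orthogonal_group Q -> Q^T *m col k Q = delta_mx k (0 : 'I_1).
  by move=> hQ; rewrite colE mulmxA hQ mul1mx.
have uv k : dot (u k) (v k) = d 0 k.
  by rewrite dotM !Ocol// dot_delta mxE eqxx mulr1n.
have u1 k : dot (u k) (u k) = 1 by rewrite dot_stiefel// dot_col_orthogonal.
have v1 k : dot (v k) (v k) = 1 by rewrite dot_stiefel// dot_col_orthogonal.
have dI k : -1 <= d 0 k <= 1 by rewrite -uv dot_unit_itv.
pose sigma := map_mx acos d.
have sE k : cos (sigma 0 k) = d 0 k by rewrite mxE acosK// in_itv/= dI.
exists A, sigma, B; split=> //; last first.
  rewrite ME (_ : map_mx cos sigma = d)//.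
  by apply/rowP => k; rewrite mxE sE.
(* The singular values decrease, so the angles are already sorted. Since [d] is nonnegative they do
   not exceed [pi / 2 = acos 0]. *)
exists 1%g; split=> [k|].
  rewrite perm1 mxE acos_ge0//= -acos0 leNgt; apply/negP => h.
  have : cos (acos (d 0 k)) < cos (acos 0).
    rewrite ltr_cos// in_itv/= acos_ge0 ?acos_lepi//; first by rewrite lerN10 ler01.
    by rewrite lerN10 ler01.
  by rewrite !acosK ?in_itv/= ?dI ?lerN10 ?ler01// ltNge d0.
have cand (U : 'M[R]_(n, p)) (Q : 'M[R]_p) k x :
    stiefel U -> orthogonal_group Q ->
    principal_candidate (colspan U) (fun j => U *m col j Q) k x ->
    exists a, [/\ x = U *m a, dot (Q^T *m a) (Q^T *m a) = 1 &
       forall j : 'I_p, (j < k)%N -> (Q^T *m a) j 0 = 0].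
  move=> hU hQ [/colspanP[a ->] x1 xj]; exists a; split=> //.
    by rewrite dot_stiefel; [rewrite -x1 dot_stiefel|exact: orthogonal_tr].
  by move=> j /xj; rewrite dot_stiefel// dot_col.
have cand_col (U : 'M[R]_(n, p)) (Q : 'M[R]_p) k : stiefel U -> orthogonal_group Q ->
    principal_candidate (colspan U) (fun j => U *m col j Q) k (U *m col k Q).
  move=> hU hQ; split; first by apply/colspanP; exists (col k Q).
    by rewrite dot_stiefel// dot_col_orthogonal.
  move=> j jk; rewrite dot_stiefel// dot_col Ocol// mxE andbT -val_eqE/=.
  by rewrite (ltn_eqF jk).
exists u, v => k; rewrite perm1 sE uv; split=> //; [exact: cand_col|exact: cand_col|].
move=> x y /cand [//|//|a [-> a1 aj]] /cand [//|//|b [-> b1 _]].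
rewrite dotM (le_trans (@dot_diag_le _ _ d (d 0 k) _ _ _ _ _))//.
  move=> i; have [ik|ki] := ltnP i k; first by left; exact: aj.
  by right; exact: ds.
by rewrite a1 b1 divff// mulr1.
Qed.

(** The principal vectors of rank [j] satisfy the fewer constraints of rank [i], so they compete in
    the earlier maximum. *)
Lemma principal_angles_sorted n p (V W : {vspace 'cV[R]_n}) (theta : 'I_p -> R) :
  principal_angles V W theta ->
  forall i j : 'I_p, (i <= j)%N -> cos (theta j) <= cos (theta i).
Proof.
move=> [_ [u [v uv]]] i j ij.
have [[uj1 uj2 uj3] [vj1 vj2 vj3] -> _] := uv j.
have [_ _ -> uvmax] := uv i.
by apply: uvmax; split=> // k ki; [apply: uj3|apply: vj3]; exact: leq_trans ij.
Qed.

End principal.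

(** * Angles between frames *)

Section angle.
Context {R : realType}.

Lemma le_acos (x y : R) : -1 <= x -> x <= y -> y <= 1 -> acos y <= acos x.
Proof.
move=> x1 xy y1; rewrite leNgt; apply/negP => h.
have xI : -1 <= x <= 1 by rewrite x1 (le_trans xy).
have yI : -1 <= y <= 1 by rewrite y1 (le_trans x1).
suff : cos (acos y) < cos (acos x) by rewrite !acosK// ltNge xy.
by rewrite ltr_cos// in_itv/= acos_ge0 ?acos_lepi.
Qed.

(** The components of [x] and [z] orthogonal to [y] have norms [sin al] and [sin be]. Cauchy-Schwarz
    for them gives [dot x z >= cos (al + be)]. *)
Lemma acos_triangle n (x y z : 'cV[R]_n) :
  dot x x = 1 -> dot y y = 1 -> dot z z = 1 ->
  acos (dot x z) <= acos (dot x y) + acos (dot y z).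
Proof.
move=> x1 y1 z1.
have [[xyI yzI] xzI] := (dot_unit_itv x1 y1, dot_unit_itv y1 z1, dot_unit_itv x1 z1).
set al := acos (dot x y); set be := acos (dot y z).
have al0 : 0 <= al by exact: acos_ge0.
have be0 : 0 <= be by exact: acos_ge0.
have cal : cos al = dot x y by rewrite acosK.
have cbe : cos be = dot y z by rewrite acosK.
have [pile|ltpi] := leP pi (al + be).
  by rewrite (le_trans _ pile)// acos_lepi.
rewrite -[leRHS]cosK; last by rewrite in_itv/= addr_ge0//= ltW.
apply: le_acos; [exact: cos_geN1| |by case/andP: xzI].
rewrite cosD cal cbe.
have sal : 0 <= sin al by rewrite sin_ge0_pi// al0 acos_lepi.
have sbe : 0 <= sin be by rewrite sin_ge0_pi// be0 acos_lepi.
(* The sign of this component is reversed so that the upper bound of Cauchy-Schwarz becomes a lower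
   bound on [dot x z]. *)
have xx : dot (-1 *: x + dot x y *: y) (-1 *: x + dot x y *: y) <= sin al ^+ 2.
  by rewrite sin2cos2 cal !(dotDl, dotDr, dotZl, dotZr) x1 y1 (dotC y x); nra.
have zz : dot (z + - dot y z *: y) (z + - dot y z *: y) <= sin be ^+ 2.
  by rewrite sin2cos2 cbe !(dotDl, dotDr, dotZl, dotZr) z1 y1 (dotC z y); nra.
have := dot_cauchy_sqrt sal sbe xx zz.
rewrite !(dotDl, dotDr, dotZl, dotZr) y1; lra.
Qed.

Lemma sin_ge_mul_cos (u : R) : 0 <= u <= pi / 2 -> u * cos u <= sin u.
Proof.
move=> /andP[]; rewrite le_eqVlt => /orP[/eqP <-|u0 upi].
  by rewrite mul0r sin0.
have [c] := @MVT _ sin cos 0 u u0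
  (fun x _ => is_derive_sin x) (continuous_subspaceT (@continuous_sin R)).
rewrite in_itv/= => /andP[c0 cu].
rewrite sin0 !subr0 => ->; rewrite mulrC ler_pM2r// ltW//.
have pi0 := pi_gt0 R.
have uI : u \in `[0, pi] by rewrite in_itv/=; apply/andP; split; lra.
have cI : c \in `[0, pi] by rewrite in_itv/=; apply/andP; split; lra.
by rewrite ltr_cos.
Qed.

(** With u = (acos x) / 2 the half-angle formulas turn this into (u cos u)^2 <= (sin u)^2. It is
    asymptotically sharp as [x] tends to 1, so small steps lose nothing to leading order. *)
Lemma acos_sqr_le (x : R) : -1 <= x <= 1 -> acos x ^+ 2 * (1 + x) <= 4 * (1 - x).
Proof.
move=> xI; set u := acos x / 2.
have uI : 0 <= u <= pi / 2.
  by rewrite divr_ge0 ?acos_ge0//= ler_pM2r ?acos_lepi// invr_gt0.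
have xE : x = cos u ^+ 2 *+ 2 - 1.
  by rewrite -cos_mulr2n -mulr_natr divfK// acosK.
have -> : acos x = u * 2 by rewrite divfK.
have := sin_ge_mul_cos uI; have := sin2cos2 u.
have cu : 0 <= cos u by apply: cos_ge0_pihalf; case/andP: uI => ? ?; have := pi_gt0 R; lra.
have u0 : 0 <= u by case/andP: uI.
rewrite {}xE; clearbody u; move: (cos u) (sin u) cu => c s c0 sc us.
have : (u * c) ^+ 2 <= s ^+ 2.
  by rewrite ler_pXn2r// nnegrE ?mulr_ge0// (le_trans _ us)// mulr_ge0.
rewrite sc exprMn; nra.
Qed.

End angle.

Lemma mxtrace_orthogonal {R : realType} p (Q N : 'M[R]_p) :
  orthogonal_group Q -> \tr (Q^T *m N *m Q) = \tr N.
Proof. by move=> hQ; rewrite mxtrace_mulC mulmxA orthogonal_mulT// mul1mx. Qed.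

Section aligned.
Context {R : realType} {n p : nat}.
Implicit Types Y Z W : 'M[R]_(n, p).

(* H transports the frame Y to the frame Z; Q is quantified after H so that the
   relation composes: the next step is applied to the frame H Q. *)
Definition aligned_within Y Z (l : R) := 0 <= l /\
  exists2 H : 'M[R]_p, orthogonal_group H & forall Q, orthogonal_group Q ->
    \sum_i acos (dot (Y *m col i Q) (Z *m H *m col i Q)) ^+ 2 <= l ^+ 2.

Lemma aligned_within_refl Y : stiefel Y -> aligned_within Y Y 0.
Proof.
move=> hY; split=> //; exists 1%:M; first exact: orthogonal1.
move=> Q hQ; rewrite mulmx1 big1 ?expr0n// => i _.
by rewrite dot_stiefel// dot_col_orthogonal// acos1 expr0n.
Qed.

Lemma aligned_within_le Y Z l l' :
  l <= l' -> aligned_within Y Z l -> aligned_within Y Z l'.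
Proof.
move=> ll' [l0 [H hH YZ]]; have l'0 := le_trans l0 ll'; split=> //.
exists H => // Q hQ; rewrite (le_trans (YZ Q hQ))// ler_pXn2r//.
Qed.

Lemma aligned_within_sym Y Z l : aligned_within Y Z l -> aligned_within Z Y l.
Proof.
move=> [l0 [H hH YZ]]; split=> //; exists H^T; first exact: orthogonal_tr.
move=> Q hQ; have hHQ := orthogonal_mul (orthogonal_tr hH) hQ.
apply: le_trans (YZ _ hHQ); apply: ler_sum => i _.
by rewrite !colE !mulmxA -(mulmxA Z H) orthogonal_mulT// mulmx1 dotC.
Qed.

(** The triangle inequality holds for each column, and Minkowski's inequality adds the two vectors
    of angles. *)
Lemma aligned_within_trans Y Z W l l' :
  stiefel Y -> stiefel Z -> stiefel W ->
  aligned_within Y Z l -> aligned_within Z W l' -> aligned_within Y W (l + l').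
Proof.
move=> hY hZ hW [l0 [H hH YZ]] [l'0 [K hK ZW]]; split; first exact: addr_ge0.
exists (K *m H) => [|Q hQ]; first exact: orthogonal_mul.
have hHQ := orthogonal_mul hH hQ.
pose y i := Y *m col i Q; pose z i := Z *m H *m col i Q.
pose w i := W *m (K *m H) *m col i Q.
have hy i : dot (y i) (y i) = 1 by rewrite dot_stiefel// dot_col_orthogonal.
have hz i : dot (z i) (z i) = 1.
  by rewrite /z -mulmxA !dot_stiefel// dot_col_orthogonal.
have hw i : dot (w i) (w i) = 1.
  by rewrite /w -!mulmxA !dot_stiefel// dot_col_orthogonal.
pose a : 'cV[R]_p := \col_i acos (dot (y i) (z i)).
pose b : 'cV[R]_p := \col_i acos (dot (z i) (w i)).
have al : dot a a <= l ^+ 2.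
  by apply: le_trans (YZ Q hQ); rewrite dotE ler_sum// => i _; rewrite mxE expr2.
have bl : dot b b <= l' ^+ 2.
  apply: le_trans (ZW _ hHQ); rewrite dotE ler_sum// => i _.
  by rewrite mxE /z /w !colE !mulmxA expr2.
apply: le_trans (dot_minkowski l0 l'0 al bl); rewrite dotE ler_sum// => i _.
have yz0 := acos_ge0 (dot_unit_itv (hy i) (hz i)).
have zw0 := acos_ge0 (dot_unit_itv (hz i) (hw i)).
have yw0 := acos_ge0 (dot_unit_itv (hy i) (hw i)).
rewrite !mxE -expr2 ler_pXn2r ?nnegrE ?addr_ge0//.
exact: (acos_triangle (hy i) (hz i) (hw i)).
Qed.

(** One small step: after realignment by the polar factor, the angles are controlled by the
    horizontal displacement [s] up to a cubic error, which disappears in the limit of short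
    steps. *)
Lemma aligned_within_close Y Z (s : R) : stiefel Y -> stiefel Z ->
  0 <= s <= 1 ->
  \tr ((Z - Y)^T *m (1%:M - Y *m Y^T) *m (Z - Y)) <= s ^+ 2 ->
  aligned_within Y Z (s * (1 + s ^+ 2)).
Proof.
move=> hY hZ /andP[s0 s1] hs; split.
  by rewrite mulr_ge0// addr_ge0 ?sqr_ge0.
have [A [B [d [hA hB ME d0 _]]]] := svd (Y^T *m Z).
have {}hs : \sum_j (1 - d 0 j ^+ 2) <= s ^+ 2.
  apply: (le_trans _ hs); rewrite le_eqVlt; apply/orP; left; apply/eqP/esym.
  (* The projection kills [Y], so the horizontal displacement only depends on the singular values of
     [Y^T *m Z]. *)
  have -> : (Z - Y)^T *m (1%:M - Y *m Y^T) *m (Z - Y) =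
            1%:M - (Y^T *m Z)^T *m (Y^T *m Z).
    have PY : (1%:M - Y *m Y^T) *m Y = 0.
      by rewrite mulmxBl mul1mx -mulmxA hY mulmx1 subrr.
    rewrite -mulmxA mulmxBr PY subr0 linearB/= mulmxBl.
    have -> : Y^T *m ((1%:M - Y *m Y^T) *m Z) = 0.
      by rewrite mulmxA mulmxBr mulmx1 mulmxA hY mul1mx subrr mul0mx.
    by rewrite subr0 mulmxBl mul1mx mulmxBr hZ trmx_mul trmxK !mulmxA.
  rewrite linearB/= mxtrace1 ME !trmx_mul tr_diag_mx trmxK.
  rewrite -!mulmxA mxtrace_mulC -!mulmxA hB mulmx1 (mulmxA A^T) hA mul1mx.
  rewrite mulmx_diag mxtrace_diag sumrB sumr_const card_ord; congr (_ - _).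
  by apply: eq_bigr => j _; rewrite mxE expr2.
have d1 j : d 0 j <= 1.
  have -> : d 0 j = dot (Y *m col j A) (Z *m col j B).
    rewrite dot_mulmx mulmxA ME !colE -!mulmxA (mulmxA B^T) hB mul1mx.
    by rewrite dot_stiefel// dot_delta mxE eqxx mulr1n.
  have yA : dot (Y *m col j A) (Y *m col j A) = 1.
    by rewrite dot_stiefel// dot_col_orthogonal.
  have zB : dot (Z *m col j B) (Z *m col j B) = 1.
    by rewrite dot_stiefel// dot_col_orthogonal.
  by case/andP: (dot_unit_itv yA zB).
(* With this H, Y^T Z H = A D A^T is symmetric positive semidefinite. *)
exists (B *m A^T); first exact/orthogonal_mul/orthogonal_tr.
move=> Q hQ; pose x i := dot (Y *m col i Q) (Z *m (B *m A^T) *m col i Q).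
have xI i : -1 <= x i <= 1.
  apply: dot_unit_itv; first by rewrite dot_stiefel// dot_col_orthogonal.
  rewrite -!mulmxA !dot_stiefel//; first by rewrite dot_col_orthogonal.
  exact: orthogonal_tr.
(* The [x i] are the diagonal entries of a conjugate of A D A^T; invariance of the trace makes the
   estimate uniform in [Q]. *)
have sum_x : \sum_i x i = \sum_j d 0 j.
  transitivity (\tr (Q^T *m (A *m diag_mx d *m A^T) *m Q)).
    apply: eq_bigr => i _; rewrite -dot_delta /x !colE.
    rewrite dot_mulmx dot_mulmx !mulmxA -(mulmxA Q^T Y^T) ME -!mulmxA.
    by rewrite (mulmxA B^T B) hB mul1mx !mulmxA.
  rewrite mxtrace_orthogonal// mxtrace_mulC mulmxA hA.
  by rewrite mul1mx mxtrace_diag.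
pose t := \sum_i (1 - x i).
have tE : t = \sum_j (1 - d 0 j) by rewrite /t !sumrB sum_x.
have s2 : 0 <= s ^+ 2 <= 1 by rewrite sqr_ge0 expr_le1.
(* Factor 1 - d^2 = (1 - d)(1 + d), where 1 + d >= 2 - s^2 because 1 - d <= 1 - d^2 <= s^2. *)
have t_le : t * (2 - s ^+ 2) <= s ^+ 2.
  apply: (le_trans _ hs); rewrite tE mulr_suml ler_sum// => j _.
  have dj2 : 1 - d 0 j ^+ 2 <= s ^+ 2.
    apply: (le_trans _ hs); rewrite [leRHS](bigD1 j)//= lerDl sumr_ge0// => k _.
    by rewrite subr_ge0 expr_le1.
  have := d0 j; have := d1 j; move: (d 0 j) dj2 => e es e1 e0.
  have e_le : 1 - e <= s ^+ 2 by nra.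
  have : 0 <= (1 - e) * (s ^+ 2 - (1 - e)) by rewrite mulr_ge0 ?subr_ge0.
  by nra.
have t0 : 0 <= t by rewrite sumr_ge0// => i _; rewrite subr_ge0; case/andP: (xI i).
have xt i : 1 - x i <= t.
  rewrite /t (bigD1 i)//= lerDl sumr_ge0// => k _.
  by rewrite subr_ge0; case/andP: (xI k).
have acos_t : (\sum_i acos (x i) ^+ 2) * (2 - s ^+ 2) <= 4 * t.
  rewrite mulr_suml /t mulr_sumr ler_sum// => i _.
  apply: le_trans (acos_sqr_le (xI i)); apply: ler_wpM2l; first exact: sqr_ge0.
  have := xt i; case/andP: s2 => ? ?; nra.
move: acos_t; rewrite -/x; have : 0 <= \sum_i acos (x i) ^+ 2.
  by rewrite sumr_ge0// => i _; exact: sqr_ge0.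
move: (\sum_i _) => S S0 St; case/andP: s2 => s20 s21.
rewrite exprMn; move: (s ^+ 2) s20 s21 t_le St => u u0 u1 tu St.
(* With u = s^2, the factor 1 + u of the conclusion comes from (1 + u)(2 - u) >= 2 on [0, 1]. *)
have h1 : S * (2 - u) ^+ 2 <= 4 * u by nra.
have h2 : 4 <= ((1 + u) * (2 - u)) ^+ 2.
  have : 2 <= (1 + u) * (2 - u) by nra.
  by nra.
have h3 : 0 < (2 - u) ^+ 2 by rewrite exprn_gt0//; lra.
rewrite -(ler_pM2r h3) (le_trans h1)//.
rewrite exprMn in h2; nra.
Qed.

End aligned.

(** * Principal angles as a lower bound for every alignment *)

Section lower_bound.
Context {R : realType} {n p : nat}.

Lemma principal_aligned_lower (U1 U2 : 'M[R]_(n, p)) O1 sigma O2 Q1 Q2 (l : R) :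
  stiefel U1 -> stiefel U2 -> principal_svd U1 U2 O1 sigma O2 ->
  orthogonal_group Q1 -> orthogonal_group Q2 ->
  aligned_within (U1 *m Q1) (U2 *m Q2) l ->
  Num.sqrt (\sum_i sigma 0 i ^+ 2) <= l.
Proof.
move=> hU1 hU2 [hO1 hO2 [s sang] ME] hQ1 hQ2 [l0 [H hH Hl]].
have sI k : 0 <= sigma 0 k <= pi / 2.
  by have [/(_ ((s^-1)%g k))] := sang; rewrite permKV.
have pi0 := pi_gt0 R.
pose c := map_mx cos sigma.
have c0 j : 0 <= c 0 j.
  by rewrite mxE cos_ge0_pihalf//; have /andP[? ?] := sI j; apply/andP; split; lra.
have cs (i j : 'I_p) : (i <= j)%N -> c 0 (s j) <= c 0 (s i).
  by move=> ij; rewrite !mxE; exact: (principal_angles_sorted sang).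
(* [A] and [B] absorb [Q1], [Q2] and [H]: the matrix of inner products of the two aligned frames
   keeps the singular values [cos sigma]. *)
pose A := Q1^T *m O1; pose B := O2^T *m Q2 *m H.
have hA : orthogonal_group A by apply: orthogonal_mul => //; exact: orthogonal_tr.
have hB : orthogonal_group B.
  by apply: orthogonal_mul => //; apply: orthogonal_mul => //; exact: orthogonal_tr.
have [Q hQ Qc] := fan_hoffman hA hB c0 cs.
have sum_l := Hl Q hQ.
rewrite -(ger0_norm l0) -sqrtr_sqr; apply: ler_wsqrtr; apply: le_trans sum_l.
(* The k-th diagonal entry is compared with the angle of index [s (rev_ord k)]; the sum of squares
   is reindexed accordingly. *)
have rev_perm : injective (fun k : 'I_p => s (rev_ord k)).
  by move=> i j /perm_inj /rev_ord_inj.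
rewrite (reindex_inj rev_perm)/=; apply: ler_sum => k _.
set x := dot _ _.
have xE : x = (Q^T *m (A *m diag_mx c *m B) *m Q) k k.
  have -> : A *m diag_mx c *m B = (U1 *m Q1)^T *m (U2 *m Q2 *m H).
    by rewrite /A /B trmx_mul !mulmxA -(mulmxA Q1^T U1^T) ME !mulmxA.
  by rewrite -dot_delta /x !colE dot_mulmx dot_mulmx !mulmxA.
have xc := Qc k; rewrite -xE in xc.
have xI : -1 <= x <= 1.
  apply: dot_unit_itv.
    by rewrite dot_stiefel ?dot_col_orthogonal//; exact: stiefel_mul.
  by rewrite dot_stiefel ?dot_col_orthogonal//; do 2 apply: stiefel_mul => //.
have /andP[s0 s1] := sI (s (rev_ord k)).
have -> : sigma 0 (s (rev_ord k)) = acos (c 0 (s (rev_ord k))).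
  by rewrite mxE cosK// in_itv/= s0/=; lra.
rewrite ler_pXn2r ?nnegrE ?acos_ge0//; last first.
  by rewrite mxE cos_geN1 cos_le1.
by apply: le_acos => //; [case/andP: xI|rewrite mxE cos_le1].
Qed.

End lower_bound.

(** * Lower bound for the length of a curve *)

Section interval_induction.
Context {R : realType}.

(** Let [c] be the supremum of the points reached from [a]. The left half of the local hypothesis
    reaches [c], and the right half would pass beyond [c] unless [c = b]. *)
Lemma interval_chain (a b : R) (P : R -> R -> Prop) : a <= b ->
  (forall x y z, a <= x <= y -> y <= z <= b -> P x y -> P y z -> P x z) ->
  (forall t, a <= t <= b -> exists2 e, 0 < e & forall s, a <= s <= b ->
     `|s - t| < e -> (s <= t -> P s t) /\ (t <= s -> P t s)) ->
  P a b.
Proof.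
move=> ab Ptrans Ploc.
pose S := [set x | a <= x <= b /\ P a x].
have Sa : S a.
  split; first by rewrite lexx.
  have [|e e0 /(_ a)] := Ploc a; first by rewrite lexx.
  by rewrite lexx ab subrr normr0 => /(_ isT e0)[h _]; exact: h.
have Sub : ubound S b by move=> x [/andP[]].
have hS : has_sup S by split; [exists a|exists b].
set c := sup S.
have ac : a <= c by exact: sup_upper_bound.
have cb : c <= b by apply: ge_sup => //; exists a.
have cI : a <= c <= b by rewrite ac.
have [e e0 Pc] := Ploc c cI.
have [x [/andP[ax xb] Pax] cx] := sup_adherent e0 hS.
have xc : x <= c by apply: sup_upper_bound => //; split=> //; rewrite ax.
have Pac : P a c.
  have xce : `|x - c| < e.
    by rewrite distrC ger0_norm ?subr_ge0//; move: cx; rewrite -/c; lra.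
  have xI : a <= x <= b by rewrite ax.
  by apply: (Ptrans a x c); rewrite ?lexx ?ax ?xc//; exact: (Pc x xI xce).1.
pose y := Num.min (c + e / 2) b.
have cy : c <= y by rewrite le_min cb andbT lerDl divr_ge0 ?ltW.
have yb : y <= b by rewrite ge_min lexx orbT.
have yc : y <= c + e / 2 by rewrite ge_min lexx.
have Pay : P a y.
  have yce : `|y - c| < e by rewrite ger0_norm ?subr_ge0//; lra.
  have yI : a <= y <= b by rewrite yb (le_trans ac).
  by apply: (Ptrans a c y); rewrite ?lexx ?ac ?cy//; exact: (Pc y yI yce).2.
have yc' : y <= c.
  by apply: sup_upper_bound => //; split=> //; rewrite yb (le_trans ac).
have [bce|ceb] := leP b (c + e / 2).
  by have <- : y = b by apply/le_anti; rewrite yb le_min bce lexx.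
have cey : c + e / 2 <= y by rewrite le_min lexx ltW.
have := le_trans cey yc'; rewrite gerDl leNgt divr_gt0//.
Qed.

End interval_induction.

(** * The horizontal part of the metric and alignment over short times *)

Section metric.
Context {R : realType} {n p : nat}.

(** For [U] in the Stiefel manifold, the squared Frobenius norm of the component of [D] orthogonal
    to span(U): the part of the metric seen by the Grassmannian. *)
Definition horizontal_metric (U D : 'M[R]_(n, p)) : R :=
  \tr (D^T *m (1%:M - U *m U^T) *m D).

Lemma mxtrace_trmx_mul_ge0 m q (X : 'M[R]_(m, q)) : 0 <= \tr (X^T *m X).
Proof.
apply: sumr_ge0 => i _; rewrite mxE sumr_ge0// => j _.
by rewrite mxE -expr2 sqr_ge0.
Qed.

Lemma horizontal_metric_ge0 U D : stiefel U -> 0 <= horizontal_metric U D.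
Proof.
move=> hU; rewrite /horizontal_metric; set P := 1%:M - _.
have PT : P^T = P by rewrite linearB/= trmx1 trmx_mul trmxK.
have PP : P *m P = P.
  rewrite {2}/P mulmxBr mulmx1 mulmxA [P *m U]mulmxBl mul1mx -mulmxA hU mulmx1.
  by rewrite subrr mul0mx subr0.
rewrite -{1}PP -{1}PT !mulmxA -trmx_mul -mulmxA.
exact: mxtrace_trmx_mul_ge0.
Qed.

(** The difference is half the squared Frobenius norm of [U^T *m D]. *)
Lemma horizontal_metric_le U D :
  horizontal_metric U D <= canonical_metric U D D.
Proof.
rewrite -subr_ge0 /canonical_metric /horizontal_metric -linearB/=.
have -> : D^T *m (1%:M - 2^-1 *: (U *m U^T)) *m D -
    D^T *m (1%:M - U *m U^T) *m D = 2^-1 *: ((U^T *m D)^T *m (U^T *m D)).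
  rewrite -mulmxBl -mulmxBr opprB addrC addrA subrK -{1}[U *m U^T]scale1r -scalerBl.
  rewrite -scalemxAr -scalemxAl trmx_mul trmxK !mulmxA; congr (_ *: _).
  by field.
by rewrite linearZ/= mulr_ge0// mxtrace_trmx_mul_ge0.
Qed.

Lemma horizontal_metricZ a U D :
  horizontal_metric U (a *: D) = a ^+ 2 * horizontal_metric U D.
Proof.
rewrite /horizontal_metric [(a *: D)^T]linearZ/= -!scalemxAl -scalemxAr scalerA.
by rewrite linearZ/= expr2.
Qed.

Definition speed (g : R -> 'M[R]_(n, p)) (t : R) : R :=
  Num.sqrt (canonical_metric (g t) (derive1 g t) (derive1 g t)).

Lemma cvg_canonical_metric {T} {F : set_system T} {FF : Filter F}
    (U D E : T -> 'M[R]_(n, p)) (u d e : 'M[R]_(n, p)) :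
  U @ F --> u -> D @ F --> d -> E @ F --> e ->
  (fun x => canonical_metric (U x) (D x) (E x)) @ F --> canonical_metric u d e.
Proof.
move=> Uu Dd Ee; apply: cvg_mxtrace; apply: cvg_mulmx => //.
apply: cvg_mulmx; first exact: cvg_trmx.
apply: cvgB; first exact: cvg_cst.
apply: cvgZl_tmp.
by apply: cvg_mulmx => //; exact: cvg_trmx.
Qed.

Lemma cvg_horizontal_metric {T} {F : set_system T} {FF : Filter F} U
    (D : T -> 'M[R]_(n, p)) (d : 'M[R]_(n, p)) :
  D @ F --> d ->
  (fun x => horizontal_metric U (D x)) @ F --> horizontal_metric U d.
Proof.
move=> Dd; apply: cvg_mxtrace; apply: cvg_mulmx => //.
by apply: cvg_mulmx; [exact: cvg_trmx|exact: cvg_cst].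
Qed.

(** A crude bound from continuity alone, for the ends of a C^1 piece, where differentiability is not
    given. The filter is left general to cover one-sided limits. *)
Lemma aligned_within_cvg (F : set_system R) {FF : Filter F}
    (g : R -> 'M[R]_(n, p)) a (eta : R) :
  stiefel (g a) -> g @ F --> g a -> 0 < eta ->
  \forall s \near F, stiefel (g s) -> aligned_within (g a) (g s) eta.
Proof.
move=> ha ga eta0; pose s0 := Num.min 1 (eta / 2).
have s0_gt0 : 0 < s0 by rewrite lt_min ltr01 divr_gt0.
have s01 : s0 <= 1 by rewrite ge_min lexx.
have s0eta : s0 <= eta / 2 by rewrite ge_min lexx orbT.
have Dg : (fun s => g s - g a) @ F --> (0 : 'M[R]_(n, p)).
  by rewrite -[X in _ --> X](subrr (g a)); apply: cvgB => //; exact: cvg_cst.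
have := cvg_horizontal_metric (U := g a) Dg.
rewrite {2}/horizontal_metric mulmx0 linear0 => h0.
have s20 : 0 < s0 ^+ 2 by rewrite exprn_gt0.
have : \forall s \near F, horizontal_metric (g a) (g s - g a) < s0 ^+ 2.
  by apply: cvgr_lt; [exact: h0|exact: s20].
apply: filterS => s /ltW hs gs.
apply: aligned_within_le (aligned_within_close ha gs _ hs); last first.
  by rewrite ltW.
nra.
Qed.

Lemma aligned_within_derivable (g : R -> 'M[R]_(n, p)) t (eps : R) :
  stiefel (g t) -> derivable g t 1 -> 0 < eps ->
  \forall s \near t, stiefel (g s) ->
    aligned_within (g t) (g s) (`|s - t| * (speed g t + eps)).
Proof.
move=> ht dg eps0; set v := speed g t.
have v0 : 0 <= v by exact: sqrtr_ge0.
pose D h := h^-1 *: (g (h + t) - g t).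
have Dg : D h @[h --> 0^'] --> derive1 g t.
  have -> : D = fun h => h^-1 *: ((g \o shift t) (h *: 1) - g t).
    by apply/funext => h; rewrite /D /= [h *: 1]mulr1.
  rewrite derive1E; exact: dg.
have v2 : horizontal_metric (g t) (derive1 g t) <= v ^+ 2.
  rewrite sqr_sqrtr ?horizontal_metric_le//.
  exact: le_trans (horizontal_metric_ge0 _ ht) (horizontal_metric_le _ _).
pose K := v + eps / 2; have K0 : 0 < K by rewrite /K; lra.
have vK : horizontal_metric (g t) (derive1 g t) < K ^+ 2.
  by rewrite (le_lt_trans v2)// ltr_pXn2r ?nnegrE ?(ltW K0)// /K; lra.
have near_K : \forall h \near 0^', horizontal_metric (g t) (D h) < K ^+ 2.
  by apply: cvgr_lt; [exact: (cvg_horizontal_metric (U := g t) Dg)|exact: vK].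
have [d /= d0 hd] := near_K.
(* For a step [h], the bound [K^-1] gives h K < 1 as [aligned_within_close] requires; the last term
   then keeps the cubic error h K (h K)^2 below h eps / 2. *)
pose e := Num.min d (Num.min K^-1 (eps / (2 * K ^+ 2))).
have e0 : 0 < e by rewrite !lt_min d0 invr_gt0 K0 divr_gt0// mulr_gt0// exprn_gt0.
exists e => // s /=; rewrite distrC => st gs.
have [->|s_t] := eqVneq s t.
  by rewrite subrr normr0 mul0r; exact: aligned_within_refl.
have := hd (s - t); rewrite /= sub0r normrN subr_eq0 s_t => /(_ _ isT) hK.
move: st; rewrite !lt_min => /and3P[std stK steps].
have {hK}/ltW := hK std; rewrite /D subrK.
move: s_t; rewrite -subr_eq0 => s_t.
rewrite horizontal_metricZ exprVn ler_pdivrMl ?exprn_even_gt0//= => hK.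
set h := `|s - t| in std stK steps *.
have h0 : 0 < h by rewrite normr_gt0.
have {}hK : horizontal_metric (g t) (g s - g t) <= (h * K) ^+ 2.
  by rewrite exprMn /h real_normK ?num_real.
have hK1 : h * K < 1 by rewrite -(mulVf (lt0r_neq0 K0)) ltr_pM2r.
have hK2 : h * K * K <= eps / 2.
  move: steps; rewrite ltr_pdivlMr ?mulr_gt0 ?exprn_gt0// => ?.
  by rewrite -mulrA -expr2; lra.
have hK0 : 0 < h * K by rewrite mulr_gt0.
apply: aligned_within_le (aligned_within_close ht gs _ hK); last first.
  by rewrite !ltW.
rewrite -mulrA ler_pM2l// mulrDr mulr1 {1}/K.
have : K * (h * K) ^+ 2 <= eps / 2.
  apply: le_trans hK2; rewrite [leRHS]mulrC ler_pM2l// expr2 -[leRHS]mulr1.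
  by rewrite ler_pM2l// ltW.
rewrite /v; lra.
Qed.

End metric.

(** * Arc length as a primitive of the speed *)

Section primitive.
Context {R : realType}.
Context (v : R -> R) (v0 : forall x, 0 <= v x)
  (mv : measurable_fun (`[0, 1]%classic : set R) v)
  (vfin : (\int[@lebesgue_measure R]_(t in `[0%R, 1%R]) (v t)%:E < +oo)%E).

Definition primitive (x : R) : R :=
  fine (\int[@lebesgue_measure R]_(t in `[0%R, x]) (v t)%:E)%E.

Let mvE : measurable_fun (`[0, 1]%classic : set R) (EFin \o v).
Proof. exact/measurable_EFinP. Qed.

Lemma primitive_fin_num x : x <= 1 ->
  (\int[@lebesgue_measure R]_(t in `[0%R, x]) (v t)%:E)%E \is a fin_num.
Proof.
move=> x1; rewrite ge0_fin_numE; last first.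
  by apply: integral_ge0 => t _; rewrite lee_fin.
apply: le_lt_trans vfin; apply: ge0_subset_integral => //.
  by move=> t _; rewrite lee_fin.
by apply: subset_itvl; rewrite bnd_simp.
Qed.

Lemma primitive_lower s t m : 0 <= s -> s <= t -> t <= 1 -> 0 <= m ->
  (forall x, s < x <= t -> m <= v x) ->
  (t - s) * m <= primitive t - primitive s.
Proof.
move=> s0 st t1 m0 mle.
have sub : `]s, t] `<=` `[0%R, 1%R].
  by move=> x /=; rewrite !in_itv/= => /andP[sx xt]; apply/andP; split; lra.
have split_int : (\int[@lebesgue_measure R]_(x in `[0%R, t]) (v x)%:E =
    \int[@lebesgue_measure R]_(x in `[0%R, s]) (v x)%:E +
    \int[@lebesgue_measure R]_(x in `]s, t]) (v x)%:E)%E.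
  have E : `[0%R, t]%classic = `[0%R, s] `|` `]s, t].
    by apply: itv_bndbnd_setU; rewrite bnd_simp.
  rewrite E; apply: ge0_integral_setU => //.
  - rewrite -E; apply: measurable_funS mvE => //.
    by apply: subset_itvl; rewrite bnd_simp.
  - by move=> x _; rewrite lee_fin.
  - apply/disj_setPS => x [] /=; rewrite !in_itv/= => /andP[_ xs] /andP[sx _].
    by rewrite ltNge xs in sx.
have low : (((t - s) * m)%:E <=
    \int[@lebesgue_measure R]_(x in `]s, t]) (v x)%:E)%E.
  have <- : (\int[@lebesgue_measure R]_(x in `]s, t]) (cst m%:E) x)%E
            = ((t - s) * m)%:E.
    rewrite integral_cst//= lebesgue_measure_itv/= lte_fin.
    have [_|ts] := ltP s t; first by rewrite -EFinB -EFinM mulrC.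
    have -> : t = s by apply/le_anti; rewrite ts st.
    by rewrite mule0 subrr mul0r.
  apply: ge0_le_integral => //.
  by apply: measurable_funS mvE.
rewrite -lee_fin EFinB /primitive !fineK ?primitive_fin_num//; last first.
  exact: le_trans st t1.
rewrite split_int [X in (X - _)%E]addeC addeK//; exact: (primitive_fin_num (le_trans st t1)).
Qed.

Lemma primitive_le s t : 0 <= s -> s <= t -> t <= 1 -> primitive s <= primitive t.
Proof.
move=> s0 st t1; rewrite -subr_ge0.
have := primitive_lower s0 st t1 (lexx 0); rewrite mulr0; apply => x _; exact: v0.
Qed.

End primitive.

Section curve.
Context {R : realType} {n p : nat}.
Context (g : R -> 'M[R]_(n, p)).

Lemma C1_on_continuous_speed a b t : C1_on a b g -> a < t < b ->
  {for t, continuous (speed g)}.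
Proof.
move=> [cg _ [dg cdg dgE]] tab.
have oab : open `]a, b[%classic by exact: itv_open.
have sub : `]a, b[ `<=` `[a, b] by exact: subset_itv_oo_cc.
have tin : t \in `]a, b[%classic by rewrite inE/= in_itv.
have ct (h : R -> 'M[R]_(n, p)) : {within `[a, b], continuous h} -> h @ t --> h t.
  by move=> /(continuous_subspaceW sub); rewrite continuous_open_subspace//; exact.
have dgt : derive1 g @ t --> derive1 g t.
  rewrite dgE//; apply: cvg_trans (ct dg cdg); apply: near_eq_cvg.
  have : \forall x \near t, `]a, b[%classic x.
    by apply: open_nbhs_nbhs; split => //; rewrite -inE.
  by apply: filterS => x /=; rewrite in_itv/= => xab; rewrite dgE.
rewrite /continuous_at /speed.
apply: (@cvg_comp _ _ _ _ Num.sqrt _ _ _ _ (@sqrt_continuous R _)).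
exact: (cvg_canonical_metric (ct g cg) dgt dgt).
Qed.

Lemma C1_on_measurable_speed a b : C1_on a b g ->
  measurable_fun (`]a, b[%classic : set R) (speed g).
Proof.
move=> hg; apply: open_continuous_measurable_fun; first exact: itv_open.
move=> t; rewrite inE/= in_itv/=; exact: C1_on_continuous_speed hg.
Qed.

(** Induction on the partition, in which a C^1 piece is prepended to an interval already treated. *)
Lemma piecewise_C1_ind (Q : R -> R -> Prop) a b : (forall c, Q c c) ->
  (forall c d e, a <= c -> c < d -> d <= e -> e <= b ->
     C1_on c d g -> Q d e -> Q c e) ->
  piecewise_C1 a b g -> Q a b.
Proof.
move=> Q0 QS [s abs hs].
(* The default value [x0] of [nth] is separated from the left end [c], which moves during the
   induction. *)
have gen x0 c : a <= c -> itv_partition c b s ->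
    (forall i, (i < size s)%N -> C1_on (nth x0 (c :: s) i) (nth x0 s i) g) -> Q c b.
  elim: s c {abs hs} => [|d s IH] c ac cbs hs.
    by rewrite (itv_partition_nil cbs); exact: Q0.
  have db := itv_partition_cons cbs.
  have cd : c < d by case: cbs => /= /andP[].
  apply: (QS c d b) => //; [exact: itv_partition_le db|exact: (hs 0%N)|].
  by apply: IH => [||i si]; [exact: le_trans (ltW cd)|exact: db|exact: (hs i.+1)].
by apply: gen hs => //; exact: lexx.
Qed.

Lemma piecewise_C1_measurable_speed a b : piecewise_C1 a b g ->
  measurable_fun (`[a, b]%classic : set R) (speed g).
Proof.
apply: (@piecewise_C1_ind (fun c d => measurable_fun (`[c, d]%classic : set R) (speed g))).
  by move=> c; rewrite set_itv1; exact: measurable_fun_set1.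
move=> {a b} c d e _ cd de _ hg mde.
have -> : `[c, e]%classic = `[c, d] `|` `]d, e] :> set R.
  by apply: itv_bndbnd_setU; rewrite bnd_simp// ltW.
apply/measurable_funU => //; split.
(* Nothing is known of the speed at the ends of the piece, but every function is measurable on a
   single point. *)
- have -> : `[c, d]%classic = [set c] `|` (`]c, d[ `|` [set d]).
    by rewrite setUitv1 ?bnd_simp// setU1itv// bnd_simp ltW.
  apply/measurable_funU => //; first exact: measurableU.
  split; first exact: measurable_fun_set1.
  apply/measurable_funU => //; split; last exact: measurable_fun_set1.
  exact: C1_on_measurable_speed.
- apply: measurable_funS mde => //.
  by apply: subset_itvr; rewrite bnd_simp.
Qed.

End curve.

(** * Alignment along a curve of finite length *)

Section curve_alignment.
Context {R : realType} {n p : nat}.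
Context (g : R -> 'M[R]_(n, p)).
Context (hg : forall t, 0 <= t <= 1 -> stiefel (g t)).
Context (mspeed : measurable_fun (`[0, 1]%classic : set R) (speed g)).
Context (gfin : (curve_length g < +oo)%E).

Let lam := primitive (speed g).

Let speed_ge0 t : 0 <= speed g t.
Proof. exact: sqrtr_ge0. Qed.

(** The bound is an increment of [lam t + eps * t], so it adds up along a chain and [interval_chain]
    reduces it to short steps, over which the speed hardly drops. *)
Lemma interior_aligned a b s t eps : 0 <= a -> b <= 1 -> C1_on a b g ->
  a < s -> s <= t -> t < b -> 0 < eps ->
  aligned_within (g s) (g t) (lam t + eps * t - (lam s + eps * s)).
Proof.
move=> a0 b1 gC as_ st tb eps0.
apply: (@interval_chain _ s t (fun x y =>
    aligned_within (g x) (g y) (lam y + eps * y - (lam x + eps * x)))) => //.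
  move=> x y z /andP[sx xy] /andP[yz zt] xy_al yz_al.
  rewrite (_ : lam z + _ - _ = (lam y + eps * y - (lam x + eps * x)) +
    (lam z + eps * z - (lam y + eps * y))); last by ring.
  by apply: (aligned_within_trans _ _ _ xy_al yz_al); apply: hg; apply/andP; split; lra.
move=> u /andP[su ut].
have hu : stiefel (g u) by apply: hg; apply/andP; split; lra.
have uab : a < u < b by apply/andP; split; lra.
(* Half of [eps] pays for the alignment rate exceeding the speed at [u], half for the drop of the
   speed near [u]. *)
have eps4 : 0 < eps / 2 by rewrite divr_gt0.
have du : derivable g u 1 by case: gC => _ h _; exact: h.
have near1 := aligned_within_derivable hu du eps4.
have near2 : \forall x \near u, speed g u - eps / 2 < speed g x.
  apply: (@cvgr_gt _ _ (nbhs u) _ _ _ (C1_on_continuous_speed gC uab)).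
  by rewrite ltrBlDr ltrDl.
have [e /= e0 he] := filterI near1 near2.
have lower x y : s <= x -> x <= y -> y <= t ->
    (forall z, x < z <= y -> `|z - u| < e) ->
    (y - x) * (speed g u - eps / 2) <= lam y - lam x.
  move=> sx xy yt hz.
  (* [primitive_lower] wants a nonnegative lower bound, hence the maximum with 0. *)
  apply: le_trans (_ : (y - x) * Num.max 0 (speed g u - eps / 2) <= _).
    by rewrite ler_wpM2l ?subr_ge0// le_max lexx orbT.
  apply: primitive_lower => //; [lra|lra|by rewrite le_max lexx|].
  move=> z /hz zu; rewrite ge_max speed_ge0/=; apply: ltW.
  by have [] := he z; rewrite /= distrC.
exists e => // x /andP[sx xt] xe.
have [|+ _] := he x; first by rewrite /= distrC.
have hx : stiefel (g x) by apply: hg; apply/andP; split; lra.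
move=> /(_ hx) ux; split=> [xu|ux'].
- have h := lower x u sx xu ut; rewrite distrC ger0_norm ?subr_ge0// in xe ux.
  apply: aligned_within_le (aligned_within_sym ux).
  suff : (u - x) * (speed g u - eps / 2) <= lam u - lam x by lra.
  apply: h => z /andP[xz zu]; rewrite distrC ger0_norm ?subr_ge0//; lra.
- have h := lower u x su ux' xt; rewrite ger0_norm ?subr_ge0// in xe ux.
  apply: aligned_within_le ux.
  suff : (x - u) * (speed g u - eps / 2) <= lam x - lam u by lra.
  apply: h => z /andP[xz zu]; rewrite ger0_norm ?subr_ge0//; lra.
Qed.

(** The two ends are crossed by continuity, at a cost [eta / 4] each. The interior uses slope
    [eta / 2] over a length at most 1. *)
Lemma C1_on_aligned a b eta : 0 <= a -> a < b -> b <= 1 -> C1_on a b g ->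
  0 < eta -> aligned_within (g a) (g b) (lam b - lam a + eta).
Proof.
move=> a0 ab b1 gC eta0.
have ha : stiefel (g a) by apply: hg; apply/andP; split; lra.
have hb : stiefel (g b) by apply: hg; apply/andP; split; lra.
have eta4 : 0 < eta / 4 by rewrite divr_gt0.
have /subspace_continuousP gc : {within `[a, b], continuous g} by case: gC.
have [d /= d0 hd] : \forall s \near a, `[a, b]%classic s -> stiefel (g s) ->
    aligned_within (g a) (g s) (eta / 4).
  apply: (@aligned_within_cvg _ _ _ (within `[a, b] (nbhs a))) => //.
  by apply: gc; rewrite /= in_itv/= lexx ltW.
have [d' /= d'0 hd'] : \forall s \near b, `[a, b]%classic s -> stiefel (g s) ->
    aligned_within (g b) (g s) (eta / 4).
  apply: (@aligned_within_cvg _ _ _ (within `[a, b] (nbhs b))) => //.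
  by apply: gc; rewrite /= in_itv/= lexx ltW.
(* A third keeps [r] strictly inside both neighbourhoods and leaves [a + r < b - r]. *)
pose r := Num.min (Num.min d d') (b - a) / 3.
have r_gt0 : 0 < r by rewrite divr_gt0// !lt_min d0 d'0 subr_gt0.
have [rd [rd' rab]] : r < d /\ r < d' /\ r * 3 <= b - a.
  have m0 : Num.min (Num.min d d') (b - a) <= b - a by rewrite ge_min lexx orbT.
  have m1 : Num.min (Num.min d d') (b - a) <= d by rewrite !ge_min lexx.
  have m2 : Num.min (Num.min d d') (b - a) <= d' by rewrite !ge_min lexx orbT.
  rewrite /r; move: (Num.min _ _) m0 m1 m2 => m m0 m1 m2.
  by split; [|split]; lra.
have hs : stiefel (g (a + r)) by apply: hg; apply/andP; split; lra.
have ht : stiefel (g (b - r)) by apply: hg; apply/andP; split; lra.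
have al1 : aligned_within (g a) (g (a + r)) (eta / 4).
  apply: hd => //=; first by rewrite opprD addNKr normrN gtr0_norm.
  by rewrite in_itv/=; apply/andP; split; lra.
have al3 : aligned_within (g (b - r)) (g b) (eta / 4).
  apply: aligned_within_sym; apply: hd' => //=.
    by rewrite opprB addrC subrK gtr0_norm.
  by rewrite in_itv/=; apply/andP; split; lra.
have al2 : aligned_within (g (a + r)) (g (b - r))
    (lam (b - r) + eta / 2 * (b - r) - (lam (a + r) + eta / 2 * (a + r))).
  by apply: (interior_aligned a0 b1) => //; lra.
have := aligned_within_trans ha ht hb (aligned_within_trans ha hs ht al1 al2) al3.
apply: aligned_within_le.
have l1 : lam a <= lam (a + r) by apply: primitive_le => //; lra.
have l2 : lam (b - r) <= lam b by apply: primitive_le => //; lra.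
have : eta / 2 * (b - r) - eta / 2 * (a + r) <= eta / 2 by nra.
lra.
Qed.

End curve_alignment.

Lemma curve_length_aligned {R : realType} {n p : nat}
    (g : R -> 'M[R]_(n, p)) (eta : R) :
  piecewise_C1 0 1 g -> (forall t, 0 <= t <= 1 -> stiefel (g t)) ->
  (curve_length g < +oo)%E -> 0 < eta ->
  aligned_within (g 0) (g 1) (fine (curve_length g) + eta).
Proof.
move=> gC hg gfin eta0; have ms := piecewise_C1_measurable_speed gC.
pose lam := primitive (speed g).
suff : forall eta, 0 < eta -> aligned_within (g 0) (g 1) (lam 1 - lam 0 + eta).
  move=> /(_ _ eta0); rewrite /lam {2}/primitive set_itv1 integral_set1 subr0.
  exact.
(* The error is quantified inside [Q], so that the first piece takes half of it and the remaining
   pieces the other half. *)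
pose Q c d := 0 <= c -> d <= 1 -> forall eta,
  0 < eta -> aligned_within (g c) (g d) (lam d - lam c + eta).
suff : Q 0 1 by apply.
apply: (piecewise_C1_ind (Q := Q) _ _ gC).
  move=> c c0 c1 e e0; apply: aligned_within_le (aligned_within_refl (hg _ _)).
    by rewrite subrr add0r ltW.
  by rewrite c0.
move=> c d e _ cd de _ gC1 IH c0 e1 eps eps0.
have eps2 : 0 < eps / 2 by rewrite divr_gt0.
have d0 : 0 <= d by lra.
have d1 : d <= 1 by lra.
have al1 := C1_on_aligned hg ms gfin c0 cd d1 gC1 eps2.
have al2 := IH d0 e1 _ eps2.
have hc : stiefel (g c) by apply: hg; apply/andP; split; lra.
have hd : stiefel (g d) by apply: hg; apply/andP; split; lra.
have he : stiefel (g e) by apply: hg; apply/andP; split; lra.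
by apply: aligned_within_le (aligned_within_trans hc hd he al1 al2); rewrite /lam; lra.
Qed.

Lemma stiefel_dist_lower {R : realType} n p (U1 U2 : 'M[R]_(n, p)) A sigma B Q1 Q2 :
  stiefel U1 -> stiefel U2 -> principal_svd U1 U2 A sigma B ->
  orthogonal_group Q1 -> orthogonal_group Q2 ->
  ((Num.sqrt (\sum_i sigma 0 i ^+ 2))%:E
     <= stiefel_dist (U1 *m Q1) (U2 *m Q2))%E.
Proof.
move=> hU1 hU2 svdU hQ1 hQ2; apply: le_ereal_inf_tmp => _ [g [gC hg g0 g1] <-].
have [gfin|] := ltP (curve_length g) +oo%E; last by rewrite leye_eq => /eqP ->; rewrite leey.
have len0 : (0 <= curve_length g)%E.
  by apply: integral_ge0 => t _; rewrite lee_fin sqrtr_ge0.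
rewrite -[leRHS]fineK ?ge0_fin_numE// lee_fin; apply/ler_addgt0Pr => e e0.
apply: (principal_aligned_lower hU1 hU2 svdU hQ1 hQ2).
by rewrite -g0 -g1; exact: curve_length_aligned.
Qed.

(** * The explicit geodesic *)

Section geodesic.
Context {R : realType} {n p : nat}.
Context (V W : 'M[R]_(n, p)) (sigma e : 'rV[R]_p).
Context (hV : stiefel V) (hVW : V^T *m W = 0) (hW : W^T *m W = diag_mx e).
(* Where sigma_j = 0 column j of W may vanish. *)
Context (he : forall j, e 0 j = 1 \/ sigma 0 j = 0).

Let comb (a b : 'rV[R]_p) : 'M[R]_(n, p) := V *m diag_mx a + W *m diag_mx b.

Let combE a b i j : comb a b i j = V i j * a 0 j + W i j * b 0 j.
Proof. by rewrite /comb !mul_mx_diag !mxE. Qed.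

(** The columns of [V] and [W] are mutually orthogonal, so all products along the curve become
    diagonal. *)
Let comb_gram a b c d : (comb a b)^T *m comb c d =
  diag_mx (\row_j (a 0 j * c 0 j + b 0 j * e 0 j * d 0 j)).
Proof.
have hWV : W^T *m V = 0 by rewrite -[LHS]trmxK trmx_mul trmxK hVW trmx0.
rewrite /comb [(_ + _)^T]linearD/= !trmx_mul !tr_diag_mx mulmxDl !mulmxDr !mulmxA.
rewrite -(mulmxA _ V^T V) hV -(mulmxA _ V^T W) hVW -(mulmxA _ W^T V) hWV.
rewrite -(mulmxA _ W^T W) hW !mulmx0 !mul0mx addr0 add0r mulmx1 !mulmx_diag.
by rewrite -linearD/=; congr diag_mx; apply/rowP => j; rewrite !mxE.
Qed.

Definition geodesic (t : R) : 'M[R]_(n, p) :=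
  comb (\row_j cos (t * sigma 0 j)) (\row_j sin (t * sigma 0 j)).

Definition geodesic_velocity (t : R) : 'M[R]_(n, p) :=
  comb (\row_j - (sigma 0 j * sin (t * sigma 0 j)))
       (\row_j (sigma 0 j * cos (t * sigma 0 j))).

Lemma geodesic_stiefel t : stiefel (geodesic t).
Proof.
rewrite /stiefel/= comb_gram; apply/matrixP => i j; rewrite !mxE.
case: (eqVneq i j) => [->|//]; congr (_ *+ _).
case: (he j) => ->; first by rewrite mulr1 -!expr2 cos2Dsin2.
by rewrite !mulr0 sin0 cos0 !mul0r mulr1 addr0.
Qed.

(** The velocity is horizontal, so the canonical metric reduces to the Frobenius norm. *)
Lemma geodesic_speed t : canonical_metric (geodesic t)
  (geodesic_velocity t) (geodesic_velocity t) = \sum_j sigma 0 j ^+ 2.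
Proof.
have hor : (geodesic t)^T *m geodesic_velocity t = 0.
  rewrite comb_gram; apply/matrixP => i j; rewrite !mxE.
  case: (he i) => ->; last by rewrite !mul0r !mulr0 oppr0 mulr0 addr0 mul0rn.
  by rewrite (_ : _ + _ = 0) ?mul0rn//; ring.
rewrite /canonical_metric -mulmxA mulmxBl mul1mx -scalemxAl -mulmxA hor mulmx0.
rewrite scaler0 subr0 comb_gram mxtrace_diag; apply: eq_bigr => j _; rewrite !mxE.
case: (he j) => ->; last by rewrite !mul0r oppr0 mulr0 add0r expr0n.
have := cos2Dsin2 (t * sigma 0 j); move: (cos _) (sin _) => c s cs; move: (sigma 0 j) => x.
by rewrite -[RHS]mulr1 -[X in _ = _ * X]cs; ring.
Qed.

Lemma is_derive_geodesic_entry (t : R) i j :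
  is_derive t (1 : R) (fun x => geodesic x i j) (geodesic_velocity t i j).
Proof.
rewrite /geodesic_velocity combE !mxE.
have -> : (fun x => geodesic x i j) = (fun x : R =>
    V i j * cos (x * sigma 0 j) + W i j * sin (x * sigma 0 j)).
  by apply/funext => x; rewrite /geodesic combE !mxE.
apply: is_derive_eq; rewrite /GRing.scale/=; ring.
Qed.

Lemma derivable_geodesic t : derivable geodesic t 1.
Proof.
by apply/derivable_mxP => i j; have [] := is_derive_geodesic_entry t i j.
Qed.

Lemma derive1_geodesic t : derive1 geodesic t = geodesic_velocity t.
Proof.
rewrite derive1E derive_mx; last exact: derivable_geodesic.
apply/matrixP => i j; rewrite mxE.
by have [_ ->] := is_derive_geodesic_entry t i j.
Qed.

Lemma continuous_comb (a b : R -> 'rV[R]_p) :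
  (forall j, continuous (fun t => a t 0 j)) ->
  (forall j, continuous (fun t => b t 0 j)) ->
  continuous (fun t => comb (a t) (b t)).
Proof.
move=> ca cb t; apply/(@cvg_mxP _ _ (nbhs t)) => i j; rewrite combE.
under eq_fun do rewrite combE.
by apply: cvgD; (apply: cvgM; first exact: cvg_cst); [exact: ca|exact: cb].
Qed.

Lemma geodesic_piecewise_C1 : piecewise_C1 0 1 geodesic.
Proof.
have ct (f : R -> R) j : continuous f -> continuous (fun t : R => f (t * sigma 0 j)).
  move=> cf t; apply: (@cvg_comp _ _ _ (fun t : R => t * sigma 0 j) f _ _ _ _ (cf _)).
  by apply: cvgM; [exact: cvg_id|exact: cvg_cst].
exists [:: 1]; first exact: itv_partition1 ltr01.
case=> // _ /=; split.
- apply: continuous_subspaceT; apply: continuous_comb => j.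
    under eq_fun do rewrite mxE; exact: ct (@continuous_cos R).
  under eq_fun do rewrite mxE; exact: ct (@continuous_sin R).
- by move=> t _; exact: derivable_geodesic.
- exists geodesic_velocity; last by move=> t _; exact: derive1_geodesic.
  apply: continuous_subspaceT; apply: continuous_comb => j.
    under eq_fun do rewrite mxE; move=> t; apply: cvgN.
    by apply: cvgM; [exact: cvg_cst|exact: ct (@continuous_sin R) t].
  under eq_fun do rewrite mxE; move=> t.
  by apply: cvgM; [exact: cvg_cst|exact: ct (@continuous_cos R) t].
Qed.

Lemma geodesic_length :
  curve_length geodesic = (Num.sqrt (\sum_j sigma 0 j ^+ 2))%:E.
Proof.
rewrite /curve_length.
under eq_integral do rewrite derive1_geodesic geodesic_speed.
by rewrite integral_cst//= lebesgue_measure_itv/= lte_fin ltr01 oppr0 adde0 mule1.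
Qed.

Lemma geodesic_dist : (stiefel_dist (geodesic 0) (geodesic 1)
  <= (Num.sqrt (\sum_j sigma 0 j ^+ 2))%:E)%E.
Proof.
rewrite -geodesic_length; apply: ereal_inf_lbound; exists geodesic => //.
by split=> //; [exact: geodesic_piecewise_C1|move=> t _; exact: geodesic_stiefel].
Qed.

Lemma geodesic0 : geodesic 0 = V.
Proof.
apply/matrixP => i j.
by rewrite /geodesic combE !mxE mul0r cos0 sin0 mulr1 mulr0 addr0.
Qed.

Lemma geodesic1E i j :
  geodesic 1 i j = V i j * cos (sigma 0 j) + W i j * sin (sigma 0 j).
Proof. by rewrite /geodesic combE !mxE mul1r. Qed.

End geodesic.

(** [X] is the part of [V2] orthogonal to [V1]; its columns are mutually orthogonal with norms
    [sin sigma], and normalizing them gives the direction [W] of the curve. *)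
Lemma stiefel_dist_upper {R : realType} n p (U1 U2 : 'M[R]_(n, p)) A sigma B :
  stiefel U1 -> stiefel U2 -> principal_svd U1 U2 A sigma B ->
  (stiefel_dist (U1 *m A) (U2 *m B)
     <= (Num.sqrt (\sum_i sigma 0 i ^+ 2))%:E)%E.
Proof.
move=> hU1 hU2 [hA hB [s sang] ME].
have sI k : 0 <= sigma 0 k <= pi / 2.
  by have [/(_ ((s^-1)%g k))] := sang; rewrite permKV.
have pi0 := pi_gt0 R.
have sin0E k : sin (sigma 0 k) = 0 -> sigma 0 k = 0.
  move=> sk; apply/eqP; rewrite eq_le; have /andP[-> sk1] := sI k; rewrite andbT.
  rewrite leNgt; apply/negP => s0; have : 0 < sin (sigma 0 k).
    by apply: sin_gt0_pi; rewrite s0/=; lra.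
  by rewrite sk ltxx.
set V1 := U1 *m A; set V2 := U2 *m B; pose c := map_mx cos sigma.
have hV1 : stiefel V1 by exact: stiefel_mul.
have hV2 : stiefel V2 by exact: stiefel_mul.
have V12 : V1^T *m V2 = diag_mx c.
  rewrite trmx_mul !mulmxA -(mulmxA A^T) ME !mulmxA hA mul1mx -mulmxA hB.
  by rewrite mulmx1.
have V21 : V2^T *m V1 = diag_mx c by rewrite -[LHS]trmxK trmx_mul trmxK V12 tr_diag_mx.
clearbody V1 V2; pose X := V2 - V1 *m diag_mx c.
have V1X : V1^T *m X = 0 by rewrite mulmxBr V12 mulmxA hV1 mul1mx subrr.
pose sn : 'rV[R]_p := \row_j sin (sigma 0 j).
have XX : X^T *m X = diag_mx (\row_j (sn 0 j ^+ 2)).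
  rewrite {1}/X [(_ - _)^T]linearB/= mulmxBl trmx_mul -mulmxA V1X mulmx0 subr0.
  rewrite /X mulmxBr hV2 mulmxA V21 mulmx_diag; apply/matrixP => i j; rewrite !mxE.
  case: (eqVneq i j) => [->|_]; last by rewrite !mulr0n subrr.
  by rewrite !mulr1n sin2cos2 expr2.
pose e : 'rV[R]_p := \row_j (sn 0 j != 0)%:R.
(* 0^-1 = 0: the columns of W with sigma_j = 0 vanish. *)
pose si : 'rV[R]_p := \row_j (sn 0 j)^-1.
pose W := X *m diag_mx si.
have hVW : V1^T *m W = 0 by rewrite mulmxA V1X mul0mx.
have hW : W^T *m W = diag_mx e.
  rewrite trmx_mul tr_diag_mx !mulmxA -(mulmxA _ X^T) XX !mulmx_diag.
  congr diag_mx; apply/rowP => j; rewrite !mxE.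
  have [->|s0] := eqVneq; first by rewrite invr0 mulr0.
  by rewrite expr2 mulrA mulVf// mul1r divff.
have he j : e 0 j = 1 \/ sigma 0 j = 0.
  by rewrite !mxE; have [/sin0E ->|_] := eqVneq; [right|left].
have := geodesic_dist hV1 hVW hW he; rewrite geodesic0.
suff -> : geodesic V1 W sigma 1 = V2 by [].
have XE i j : X i j = V2 i j - V1 i j * cos (sigma 0 j).
  by rewrite /X mul_mx_diag !mxE.
apply/matrixP => i j; rewrite geodesic1E /W mul_mx_diag mxE [si _ _]mxE [sn _ _]mxE.
(* Where the sine vanishes, column [j] of [X] has norm zero, so [V2] agrees there with [V1] times
   the cosine. *)
have [s0|s0] := eqVneq (sin (sigma 0 j)) 0.
  have : X *m delta_mx j (0 : 'I_1) = 0.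
    by apply: dot_eq0; rewrite dot_mulmx mulmxA XX dot_delta !mxE eqxx s0 expr0n.
  rewrite -colE => /colP/(_ i); rewrite mxE XE mxE => /subr0_eq ->.
  by rewrite s0 mulr0 addr0.
by rewrite -mulrA mulVf// mulr1 XE addrC subrK.
Qed.

Theorem proposition2 (R : realType) (n p : nat) (hp : (1 <= p)%N)
    (hpn : (p <= n)%N) (U1 U2 : 'M[R]_(n, p))
    (hU1 : stiefel U1) (hU2 : stiefel U2)
    (hangles : forall theta : 'I_p -> R,
       principal_angles (colspan U1) (colspan U2) theta ->
       forall k, theta k < pi / 2) :
  (exists (O1 : 'M[R]_p) (sigma : 'rV[R]_p) (O2 : 'M[R]_p),
     principal_svd U1 U2 O1 sigma O2) /\
  (forall (O1 : 'M[R]_p) (sigma : 'rV[R]_p) (O2 : 'M[R]_p),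
     principal_svd U1 U2 O1 sigma O2 ->
     forall Q1 Q2 : 'M[R]_p, orthogonal_group Q1 -> orthogonal_group Q2 ->
       (stiefel_dist (U1 *m O1) (U2 *m O2)
          <= stiefel_dist (U1 *m Q1) (U2 *m Q2))%E).
Proof.
split; first exact: principal_svd_exists.
move=> O1 sigma O2 svdU Q1 Q2 hQ1 hQ2.
(* The two bounds meet at the Grassmann distance of the spans, which no choice of [Q1] and [Q2]
   affects. *)
apply: le_trans (stiefel_dist_upper hU1 hU2 svdU) _.
exact: stiefel_dist_lower hU1 hU2 svdU hQ1 hQ2.
Qed.
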